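(* Let $\vec B\in C^3(\mathbb{R}^2,\mathbb{R}^2)$ satisfy the standing sign conditions listed in the context, let $\alpha\in(0,d/2)$, and let $D_\alpha\subset(0,d/2)\times\mathbb{R}$ and $F$ be as in the context. Then, for all $f\in C^2(D_\alpha)$ and all $P,Q\in C^2((0,\alpha))$, there exists a unique function $u\in C^2(D_\alpha)$ such that $$\left\{\begin{array}{ll} -\Delta_\parallel u:=-\nabla\cdot\big((\vec b\otimes\vec b)\nabla u\big)=f & \text{in } D_\alpha,\\ u(x_0,L/2)=P(x_0) & \text{for all } x_0\in(0,\alpha),\\ \langle\nabla u,\vec b\rangle(x_0,L/2)=\partial_y u(x_0,L/2)=Q(x_0) & \text{for all } x_0\in(0,\alpha). \end{array}\right.$$ Moreover, for all $(x_0,t)\in(0,\alpha)\times\mathbb{R}$, $$u\circ F(x_0,t)=P(x_0)+Q(x_0)\int_0^t e^{-\mathcal H(x_0,s)}\,ds+\int_0^t\Big(e^{-\mathcal H(x_0,v)}\int_0^v\tilde f(x_0,s)\,e^{\mathcal H(x_0,s)}\,ds\Big)dv,$$ where $\tilde H(x_0,t):=\mathrm{Tr}\big(D\vec b(\Phi_t(x_0,L/2))\big)$, $\mathcal H(x_0,s):=\int_0^s\tilde H(x_0,t)\,dt$ and $\tilde f(x_0,t):=-f(\Phi_t(x_0,L/2))$ for all $x_0\in(0,\alpha)$ and $s,t\in\mathbb{R}$.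
   Context: Standing conditions on $\vec B=(B_x,B_y)$: there are constants $\varepsilon,d,L>0$ such that, with $S:=(d/2,L/2)$, for $(x,y)\in(-\varepsilon,d+\varepsilon)\times\mathbb{R}$ one has $\vec B(x,y)=\vec 0$ if and only if $(x,y)=S$, and moreover: $B_x>0$ in $(0,d)\times(-\infty,L/2)$ and $B_x<0$ in $(0,d)\times(L/2,+\infty)$; $B_x<0$ in $(-\varepsilon,0)\times(-\infty,L/2)$ and $B_x>0$ in $(-\varepsilon,0)\times(L/2,+\infty)$; $B_y>0$ in $(-\varepsilon,d/2)\times\mathbb{R}$ and $B_y<0$ in $(d/2,d+\varepsilon)\times\mathbb{R}$; $B_x(0,y)=B_x(d,y)=0$ for all $y\in\mathbb{R}$; $B_y(x,L)>0$ and $B_y(x,0)>0$ for $0\le x<d/2$. The normalized field is $\vec b:=\vec B/\|\vec B\|$ on $((-\varepsilon,d+\varepsilon)\times\mathbb{R})\setminus\{S\}$ (Euclidean norm); $D\vec b$ is its Jacobian matrix. The flow $t\mapsto\Phi_t(p)$ is the solution of $\frac{d}{dt}\Phi_t(p)=\vec b(\Phi_t(p))$, $\Phi_0(p)=p$; trajectories starting at $(x_0,L/2)$ with $-\varepsilon/2<x_0<d/2$ are defined for all $t\in\mathbb{R}$. For $\alpha\in(0,d/2)$ write $(x_\alpha(t),y_\alpha(t)):=\Phi_t(\alpha,L/2)$, $t\in\mathbb{R}$; $y_\alpha$ is a $C^1$-diffeomorphism from $\mathbb{R}$ onto an open interval $I\supset[0,L]$. Define $D_\alpha:=\{(x,y)\in(0,d/2)\times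 I:\ 0<x<x_\alpha(y_\alpha^{-1}(y))\}$ and $F:(0,\alpha)\times\mathbb{R}\to D_\alpha$, $F(x_0,t):=\Phi_t(x_0,L/2)$, which is a $C^1$-diffeomorphism. *)

(* Defs.v *)
From Stdlib Require Export Reals.
From Coquelicot Require Export Coquelicot.
Open Scope R_scope.

Definition vec : Type := (R * R)%type.

Definition vfield : Type := R -> R -> vec.

(* A 2 x 2 matrix is the pair of its rows. *)
Definition mat2 : Type := (vec * vec)%type.

Definition dot (v w : vec) : R := fst v * fst w + snd v * snd w.

Definition enorm (v : vec) : R := sqrt (fst v ^ 2 + snd v ^ 2).

Definition mulmv (M : mat2) (w : vec) : vec := (dot (fst M) w, dot (snd M) w).

Definition trace2 (M : mat2) : R := fst (fst M) + snd (snd M).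

Definition tensor (v w : vec) : mat2 :=
  ((fst v * fst w, fst v * snd w), (snd v * fst w, snd v * snd w)).

(* The differential operators below use the total [Derive]; they are only
   evaluated at points of open sets where the fields are at least C^1. *)
Definition d_x (g : R -> R -> R) (x y : R) : R := Derive (fun z => g z y) x.
Definition d_y (g : R -> R -> R) (x y : R) : R := Derive (fun z => g x z) y.

Definition grad (g : R -> R -> R) : vfield := fun x y => (d_x g x y, d_y g x y).

Definition comp1 (V : vfield) (x y : R) : R := fst (V x y).
Definition comp2 (V : vfield) (x y : R) : R := snd (V x y).

Definition jacobian (V : vfield) (x y : R) : mat2 :=
  (grad (comp1 V) x y, grad (comp2 V) x y).

Definition divergence (V : vfield) (x y : R) : R :=
  d_x (comp1 V) x y + d_y (comp2 V) x y.

(* C^k on an open set: a function defined on an open set U only is represented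
   by a total function whose values outside U are irrelevant.  [ex_diff_n g k]
   says that all iterated partial derivatives of g of order at most k exist and
   are continuous (in both variables jointly). *)
Definition Ck_plane (k : nat) (U : R -> R -> Prop) (g : R -> R -> R) : Prop :=
  forall x y, U x y -> ex_diff_n g k x y.

Definition Ck_line (k : nat) (U : R -> Prop) (g : R -> R) : Prop :=
  forall x, U x -> forall j, (j <= k)%nat ->
    ex_derive_n g j x /\ continuous (Derive_n g j) x.

Definition strip (eps d : R) (x y : R) : Prop := - eps < x < d + eps.

Record standing_conditions (B : vfield) (eps d L : R) : Prop := {
  sc_eps : 0 < eps;
  sc_d : 0 < d;
  sc_L : 0 < L;
  sc_zero : forall x y, strip eps d x y ->
    (B x y = (0, 0) <-> (x, y) = (d / 2, L / 2));
  sc_Bx_in_low : forall x y, 0 < x < d -> y < L / 2 -> comp1 B x y > 0;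
  sc_Bx_in_up : forall x y, 0 < x < d -> y > L / 2 -> comp1 B x y < 0;
  sc_Bx_out_low : forall x y, - eps < x < 0 -> y < L / 2 -> comp1 B x y < 0;
  sc_Bx_out_up : forall x y, - eps < x < 0 -> y > L / 2 -> comp1 B x y > 0;
  sc_By_left : forall x y, - eps < x < d / 2 -> comp2 B x y > 0;
  sc_By_right : forall x y, d / 2 < x < d + eps -> comp2 B x y < 0;
  sc_Bx_walls : forall y, comp1 B 0 y = 0 /\ comp1 B d y = 0;
  sc_By_ends : forall x, 0 <= x < d / 2 -> comp2 B x L > 0 /\ comp2 B x 0 > 0
}.

(* Meaningful away from the zeros of B. *)
Definition normalized (B : vfield) : vfield :=
  fun x y => (comp1 B x y / enorm (B x y), comp2 B x y / enorm (B x y)).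

Definition punctured_strip (eps d L : R) (x y : R) : Prop :=
  strip eps d x y /\ (x, y) <> (d / 2, L / 2).

Definition is_trajectory (b : vfield) (U : R -> R -> Prop) (p : vec)
    (gamma : R -> vec) : Prop :=
  gamma 0 = p /\
  forall t,
    U (fst (gamma t)) (snd (gamma t)) /\
    is_derive (fun s => fst (gamma s)) t
              (comp1 b (fst (gamma t)) (snd (gamma t))) /\
    is_derive (fun s => snd (gamma s)) t
              (comp2 b (fst (gamma t)) (snd (gamma t))).

(* The flow of b, on the starting points (x0, L/2), -eps/2 < x0 < d/2, whose
   trajectories are global in time.  Since b is locally Lipschitz on the
   punctured strip, these values of Phi are determined by this condition. *)
Definition is_flow (B : vfield) (eps d L : R) (Phi : R -> vec -> vec) : Prop :=
  forall x0, - eps / 2 < x0 < d / 2 ->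
    is_trajectory (normalized B) (punctured_strip eps d L) (x0, L / 2)
                  (fun t => Phi t (x0, L / 2)).

Definition x_traj (Phi : R -> vec -> vec) (L alpha t : R) : R :=
  fst (Phi t (alpha, L / 2)).
Definition y_traj (Phi : R -> vec -> vec) (L alpha t : R) : R :=
  snd (Phi t (alpha, L / 2)).

(* y_traj is strictly increasing in t, so the t below is the inverse image of y
   under it, and its existence says that y lies in the range I of y_traj. *)
Definition D_region (Phi : R -> vec -> vec) (d L alpha : R) (x y : R) : Prop :=
  0 < x < d / 2 /\
  exists t, y_traj Phi L alpha t = y /\ 0 < x < x_traj Phi L alpha t.

Definition F_map (Phi : R -> vec -> vec) (L x0 t : R) : vec :=
  Phi t (x0, L / 2).

Definition Delta_par (b : vfield) (u : R -> R -> R) : R -> R -> R :=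
  divergence (fun x y => mulmv (tensor (b x y) (b x y)) (grad u x y)).

Definition is_solution (B : vfield) (L alpha : R) (D : R -> R -> Prop)
    (f : R -> R -> R) (P Q : R -> R) (u : R -> R -> R) : Prop :=
  let b := normalized B in
  Ck_plane 2 D u /\
  (forall x y, D x y -> - Delta_par b u x y = f x y) /\
  (forall x0, 0 < x0 < alpha -> u x0 (L / 2) = P x0) /\
  (forall x0, 0 < x0 < alpha ->
     dot (grad u x0 (L / 2)) (b x0 (L / 2)) = d_y u x0 (L / 2) /\
     d_y u x0 (L / 2) = Q x0).

Definition H_tilde (B : vfield) (Phi : R -> vec -> vec) (L x0 t : R) : R :=
  trace2 (uncurry (jacobian (normalized B)) (Phi t (x0, L / 2))).

Definition H_cal (B : vfield) (Phi : R -> vec -> vec) (L x0 s : R) : R :=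
  RInt (fun t => H_tilde B Phi L x0 t) 0 s.

Definition f_tilde (f : R -> R -> R) (Phi : R -> vec -> vec) (L x0 t : R) : R :=
  - uncurry f (Phi t (x0, L / 2)).

(* Main.v *)
Require Import Defs.
From Stdlib Require Import Reals Ranalysis5 Lra Lia Classical ClassicalEpsilon.
From Coquelicot Require Import Coquelicot.
Open Scope R_scope.

(* On the left half of the strip [b_y > 0], so trajectories are graphs
   [x = X x0 y] over the whole y axis, where [X] is the flow of the scalar equation
   [dx/dy = g x y = b_x / b_y] from the height [y0 = L / 2].  The difference of
   two solutions is the initial difference times the exponential of an integral of
   difference quotients of [g], so [X] is increasing in [x0] with derivative
   [exp (int g_x)].  For [p] the inverse of [X] in its first variable, let
   [G h (x, y)] be the integral of [h] along the trajectory through [(x, y)], from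
   height [y0] to [y].  Then [p_x = exp (- G g_x)] and
   [d_x (G h) = p_x * G (h_x / p_x)], [d_y (G h) = h - g * d_x (G h)], which gives by
   induction that [G] preserves the class C^k.
   With [w = <grad u, b>], the equation reads [<grad w, b> + (div b) w = - f],
   i.e. two successive linear equations along the trajectories, solved by [G]
   with [dt = dy / b_y]. *)

(** * One-variable calculus *)

(** With the height as parameter, straightening the flow amounts to inverting one function of one
    variable, and monotonicity of [X] replaces an inverse function theorem in the plane.
    Trajectories cover the whole axis for three reasons. Forward in time above [y0], and backward in
    time below it, [b_x] drives them towards the wall [x = 0], hence away from the zero of the
    field. The wall is not reached, because [b_x] vanishes there at least linearly. On bounded
    rectangles left of that zero, [b_y] has a positive lower bound. The point [(x, y)] enters [G h]
    through the upper bound of the integral and through the trajectory itself. Its derivative in [y]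
    is therefore not computed directly: it is deduced from the derivative along the trajectory,
    which is [h], and from the continuous derivative in [x]. The latter is again built from [G],
    applied to [g_x] and [h_x], so the induction needs [g] and [g_x] of the same class as [h]. Since
    [B] is C^3, [g_x] is C^2, which is what a solution of class C^2 requires. *)

Lemma is_derive_continuity_pt (f : R -> R) (x l : R) :
  is_derive f x l -> continuity_pt f x.
Proof.
  intros H. apply continuity_pt_filterlim.
  apply (ex_derive_continuous f x). now exists l.
Qed.

Lemma is_derive_Rplus (f g : R -> R) (x lf lg : R) :
  is_derive f x lf -> is_derive g x lg ->
  is_derive (fun z => f z + g z) x (lf + lg).
Proof. apply (is_derive_plus f g). Qed.

Lemma is_derive_Rminus (f g : R -> R) (x lf lg : R) :
  is_derive f x lf -> is_derive g x lg ->
  is_derive (fun z => f z - g z) x (lf - lg).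
Proof. apply (is_derive_minus f g). Qed.

Lemma is_derive_Ropp (f : R -> R) (x l : R) :
  is_derive f x l -> is_derive (fun z => - f z) x (- l).
Proof. apply (is_derive_opp f). Qed.

Lemma is_derive_Rmult (f g : R -> R) (x lf lg : R) :
  is_derive f x lf -> is_derive g x lg ->
  is_derive (fun z => f z * g z) x (lf * g x + f x * lg).
Proof.
  intros Hf Hg. apply is_derive_Reals.
  apply (derivable_pt_lim_mult f g); now apply is_derive_Reals.
Qed.

Lemma is_derive_Rcomp (f g : R -> R) (x lf lg : R) :
  is_derive f (g x) lf -> is_derive g x lg ->
  is_derive (fun z => f (g z)) x (lf * lg).
Proof.
  intros Hf Hg. apply is_derive_Reals.
  apply (derivable_pt_lim_comp g f); now apply is_derive_Reals.
Qed.

Lemma is_derive_Rconst (c x : R) : is_derive (fun _ => c) x 0.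
Proof. apply (is_derive_const c). Qed.

Lemma is_derive_exp_comp (f : R -> R) (x l : R) :
  is_derive f x l -> is_derive (fun z => exp (f z)) x (l * exp (f x)).
Proof.
  intros H. rewrite Rmult_comm. apply (is_derive_Rcomp exp f); [|exact H].
  apply is_derive_Reals, derivable_pt_lim_exp.
Qed.

Lemma continuity_pt_eps (f : R -> R) (x : R) :
  continuity_pt f x ->
  forall e, 0 < e -> exists r, 0 < r /\
    forall x', Rabs (x' - x) < r -> Rabs (f x' - f x) < e.
Proof.
  intros H e He.
  destruct (proj1 (continuity_pt_locally f x) H (mkposreal e He)) as [r Hr].
  exists r. split; [apply cond_pos|]. intros x' Hx'. apply (Hr x' Hx').
Qed.

Lemma eps_continuity_pt (f : R -> R) (x : R) :
  (forall e, 0 < e -> exists r, 0 < r /\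
    forall x', Rabs (x' - x) < r -> Rabs (f x' - f x) < e) ->
  continuity_pt f x.
Proof.
  intros H. apply (proj2 (continuity_pt_locally f x)). intros e.
  destruct (H e (cond_pos e)) as [r [Hr Hr']].
  exists (mkposreal r Hr). intros x' Hx'. apply Hr', Hx'.
Qed.

Lemma mvt_between (f df : R -> R) (a b : R) :
  (forall x, Rmin a b <= x <= Rmax a b -> is_derive f x (df x)) ->
  exists c, Rmin a b <= c <= Rmax a b /\ f b - f a = df c * (b - a).
Proof.
  intros H. apply (MVT_gen f a b df).
  - intros x Hx. apply H. lra.
  - intros x Hx. apply is_derive_continuity_pt with (df x). now apply H.
Qed.

Lemma mvt_open (f df : R -> R) (a b : R) :
  a < b -> (forall x, a <= x <= b -> is_derive f x (df x)) ->
  exists c, a < c < b /\ f b - f a = df c * (b - a).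
Proof.
  intros Hab H. destruct (MVT_cor2 f df a b Hab) as [c [Hc1 Hc2]].
  - intros c Hc. apply is_derive_Reals. now apply H.
  - exists c. now split.
Qed.

Lemma derive_zero_const (f : R -> R) :
  (forall x, is_derive f x 0) -> forall a b, f a = f b.
Proof.
  intros H a b. destruct (mvt_between f (fun _ => 0) a b) as [c [_ Hc]].
  - intros x _. apply H.
  - lra.
Qed.

(** [z ^ 2 * exp (- 2 * M * t)] is nonincreasing and [z ^ 2 * exp (2 * M * t)] is nondecreasing; the
    first spreads the zero at [c] to the right, the second to the left. Squaring avoids
    differentiating an absolute value. *)
Lemma gronwall_zero (z dz : R -> R) (M a b c : R) :
  (forall t, a <= t <= b -> is_derive z t (dz t)) ->
  (forall t, a <= t <= b -> Rabs (dz t) <= M * Rabs (z t)) ->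
  a <= c <= b -> z c = 0 -> forall t, a <= t <= b -> z t = 0.
Proof.
  intros Hd HM Hc Hz t Ht.
  assert (Hq : forall s, a <= s <= b ->
            Rabs (2 * z s * dz s) <= 2 * M * z s ^ 2).
  { intros s Hs. specialize (HM s Hs).
    rewrite !Rabs_mult, (Rabs_right 2) by lra.
    rewrite <- (pow2_abs (z s)).
    assert (0 <= Rabs (z s)) by apply Rabs_pos. nra. }
  assert (Hw : forall k s, a <= s <= b ->
            is_derive (fun s => z s ^ 2 * exp (k * s)) s
              ((2 * z s * dz s + k * z s ^ 2) * exp (k * s))).
  { intros k s Hs. specialize (Hd s Hs). auto_derive.
    - now exists (dz s).
    - replace (Derive (fun x => z x) s) with (dz s)
        by (symmetry; now apply is_derive_unique).
      ring. }
  assert (Hzero : forall k, z t ^ 2 * exp (k * t) <= 0 -> z t = 0).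
  { intros k Hk. assert (He := exp_pos (k * t)).
    assert (0 <= z t ^ 2) by apply pow2_ge_0.
    assert (z t ^ 2 = 0) by nra. nra. }
  destruct (Rle_lt_dec c t) as [Hct|Hct].
  - apply (Hzero (- (2 * M))).
    destruct (mvt_between (fun s => z s ^ 2 * exp (- (2 * M) * s)) _ c t
                (fun s Hs => Hw (- (2 * M)) s ltac:(
                   rewrite Rmin_left, Rmax_right in Hs by lra; lra)))
      as [s [Hs E]].
    rewrite Rmin_left, Rmax_right in Hs by lra.
    rewrite Hz in E. assert (H1 := Hq s ltac:(lra)).
    assert (H2 := Rle_abs (2 * z s * dz s)).
    assert (H3 := exp_pos (- (2 * M) * s)).
    assert ((2 * z s * dz s + - (2 * M) * z s ^ 2) * exp (- (2 * M) * s) <= 0)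
      by nra.
    nra.
  - apply (Hzero (2 * M)).
    destruct (mvt_between (fun s => z s ^ 2 * exp (2 * M * s)) _ t c
                (fun s Hs => Hw (2 * M) s ltac:(
                   rewrite Rmin_left, Rmax_right in Hs by lra; lra)))
      as [s [Hs E]].
    rewrite Rmin_left, Rmax_right in Hs by lra.
    rewrite Hz in E. assert (H1 := Hq s ltac:(lra)).
    assert (H2 := Rle_abs (- (2 * z s * dz s))). rewrite Rabs_Ropp in H2.
    assert (H3 := exp_pos (2 * M * s)).
    assert (0 <= (2 * z s * dz s + 2 * M * z s ^ 2) * exp (2 * M * s))
      by nra.
    nra.
Qed.

(** Induction on the half-line: the supremum [T] of the times up to which [A] holds satisfies [A] by
    the closure hypothesis, and openness then carries [A] beyond [T]. *)
Lemma forward_induction (A : R -> Prop) :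
  A 0 ->
  (forall t, 0 <= t -> A t -> exists r, 0 < r /\ forall s, Rabs (s - t) < r -> A s) ->
  (forall t, 0 < t -> (forall s, 0 <= s < t -> A s) -> A t) ->
  forall t, 0 <= t -> A t.
Proof.
  intros H0 Ho Hc t Ht. apply NNPP. intros Hn.
  set (E := fun s => 0 <= s /\ forall r, 0 <= r <= s -> A r).
  assert (HE : bound E).
  { exists t. intros s [Hs Hs']. apply Rnot_lt_le. intros Hts.
    apply Hn, Hs'. lra. }
  assert (HE0 : E 0).
  { split; [lra|]. intros r Hr. now replace r with 0 by lra. }
  destruct (completeness E HE (ex_intro _ 0 HE0)) as [T [HT1 HT2]].
  assert (HT0 : 0 <= T) by (apply HT1, HE0).
  assert (Hlt : forall s, 0 <= s < T -> A s).
  { intros s Hs. apply NNPP. intros Hns.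
    assert (T <= s); [|lra]. apply HT2. intros r [Hr Hr'].
    apply Rnot_lt_le. intros Hsr. apply Hns, Hr'. lra. }
  assert (HAT : A T).
  { destruct (Req_dec T 0) as [->|HT]; [exact H0|]. apply Hc; [lra|exact Hlt]. }
  destruct (Ho T HT0 HAT) as [r [Hr Hr']].
  assert (T + r / 2 <= T); [|lra]. apply HT1. split; [lra|].
  intros s Hs. destruct (Rlt_le_dec s T) as [HsT|HsT].
  - apply Hlt. lra.
  - apply Hr'. rewrite Rabs_right; lra.
Qed.

(** The slope is existential so that it can be supplied as a mean value or an exponential instead of
    a quotient. *)
Lemma is_derive_slope (f : R -> R) (x l : R) :
  (forall e, 0 < e -> exists r, 0 < r /\
     forall x', Rabs (x' - x) < r -> x' <> x ->
       exists s, f x' - f x = s * (x' - x) /\ Rabs (s - l) < e) ->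
  is_derive f x l.
Proof.
  intros H. apply is_derive_Reals. intros e He.
  destruct (H e He) as [r [Hr Hr']].
  exists (mkposreal r Hr). intros h Hh Hhr. simpl in Hhr.
  destruct (Hr' (x + h)) as [s [Hs1 Hs2]].
  - now replace (x + h - x) with h by ring.
  - lra.
  - rewrite Hs1. replace (x + h - x) with h by ring.
    now replace (s * h / h) with s by (now field).
Qed.

Lemma is_derive_eps (f : R -> R) (x l : R) :
  is_derive f x l ->
  forall e, 0 < e -> exists r, 0 < r /\
    forall x', Rabs (x' - x) < r ->
      Rabs (f x' - f x - l * (x' - x)) <= e * Rabs (x' - x).
Proof.
  intros H e He. apply is_derive_Reals in H.
  destruct (H e He) as [r Hr]. exists r. split; [apply cond_pos|].
  intros x' Hx'. destruct (Req_dec x' x) as [->|Hne].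
  - rewrite !Rminus_diag, Rmult_0_r, Rminus_0_r, Rabs_R0. lra.
  - assert (Hd : x' - x <> 0) by lra.
    specialize (Hr (x' - x) Hd Hx').
    replace (x + (x' - x)) with x' in Hr by ring.
    replace (f x' - f x - l * (x' - x))
      with (((f x' - f x) / (x' - x) - l) * (x' - x)) by (now field).
    rewrite Rabs_mult. assert (0 <= Rabs (x' - x)) by apply Rabs_pos. nra.
Qed.

Lemma is_derive_slope_lim (f : R -> R) (x l : R) :
  is_derive f x l ->
  forall e, 0 < e -> exists r, 0 < r /\
    forall x', Rabs (x' - x) < r -> x' <> x ->
      Rabs ((f x' - f x) / (x' - x) - l) < e.
Proof.
  intros H e He. apply is_derive_Reals in H.
  destruct (H e He) as [r Hr]. exists r. split; [apply cond_pos|].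
  intros x' Hx' Hne. specialize (Hr (x' - x) ltac:(lra) Hx').
  now replace (x + (x' - x)) with x' in Hr by ring.
Qed.

(** Continuity of the right inverse [q] at the point is enough: the expansion of [f] at [q x] first
    makes [q] Lipschitz at [x], then gives its slope. *)
Lemma is_derive_inverse (f q : R -> R) (x l : R) :
  is_derive f (q x) l -> l <> 0 -> continuity_pt q x ->
  (exists r, 0 < r /\ forall x', Rabs (x' - x) < r -> f (q x') = x') ->
  is_derive q x (/ l).
Proof.
  intros Hf Hl Hq [r0 [Hr0 Hinv]].
  assert (Hla : 0 < Rabs l) by now apply Rabs_pos_lt.
  apply is_derive_slope. intros e He.
  (* The first bound absorbs the error term and yields [Rabs l * Rabs D <= 2 * Rabs h]; with it the
     second makes the final error at most half of the allowed one. *)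
  set (n := Rmin (Rabs l / 2) (e * (Rabs l * Rabs l) / 4)).
  assert (Hn : 0 < n).
  { apply Rmin_pos; [lra|]. assert (0 < e * (Rabs l * Rabs l)) by
      (apply Rmult_lt_0_compat; nra). lra. }
  assert (Hn1 : n <= Rabs l / 2) by apply Rmin_l.
  assert (Hn2 : n <= e * (Rabs l * Rabs l) / 4) by apply Rmin_r.
  destruct (is_derive_eps _ _ _ Hf n Hn) as [r1 [Hr1 H1]].
  destruct (continuity_pt_eps _ _ Hq r1 Hr1) as [r2 [Hr2 H2]].
  exists (Rmin r0 r2). split; [now apply Rmin_pos|].
  intros x' Hx' Hne.
  assert (Hxa := Rlt_le_trans _ _ _ Hx' (Rmin_l _ _)).
  assert (Hxb := Rlt_le_trans _ _ _ Hx' (Rmin_r _ _)).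
  specialize (H1 (q x') (H2 x' Hxb)).
  rewrite (Hinv x' Hxa), (Hinv x) in H1
    by (rewrite Rminus_diag, Rabs_R0; lra).
  exists ((q x' - q x) / (x' - x)). split; [field; lra|].
  set (D := q x' - q x) in *. set (h := x' - x) in *.
  assert (Hh : 0 < Rabs h) by (apply Rabs_pos_lt; unfold h; lra).
  assert (HD : Rabs l * Rabs D <= 2 * Rabs h).
  { rewrite <- Rabs_mult.
    assert (Rabs (l * D) <= Rabs h + Rabs (h - l * D)).
    { replace (l * D) with (h - (h - l * D)) at 1 by ring.
      eapply Rle_trans; [apply Rabs_triang|]. rewrite Rabs_Ropp. lra. }
    rewrite Rabs_mult in *. assert (0 <= Rabs D) by apply Rabs_pos. nra. }
  replace (D / h - / l) with (- (h - l * D) / (l * h))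
    by (field; split; [exact Hl|unfold h; lra]).
  unfold Rdiv. rewrite Rabs_mult, Rabs_Ropp, Rabs_inv, Rabs_mult.
  apply Rmult_lt_reg_r with (Rabs l * Rabs h);
    [now apply Rmult_lt_0_compat|].
  rewrite Rmult_assoc, Rinv_l, Rmult_1_r
    by (apply Rgt_not_eq; now apply Rmult_lt_0_compat).
  apply Rle_lt_trans with (n * Rabs D); [exact H1|].
  assert (0 <= Rabs D) by apply Rabs_pos.
  assert (n * Rabs D <= e * (Rabs l * Rabs l) / 4 * Rabs D) by nra.
  assert (e * Rabs l / 4 * (Rabs l * Rabs D) <= e * Rabs l / 4 * (2 * Rabs h)).
  { apply Rmult_le_compat_l; [|exact HD].
    assert (0 < e * Rabs l) by now apply Rmult_lt_0_compat. lra. }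
  assert (0 < e * (Rabs l * Rabs h)) by
    (apply Rmult_lt_0_compat; [|apply Rmult_lt_0_compat]; assumption).
  nra.
Qed.

Lemma increasing_bijection_inverse (y dy : R -> R) :
  (forall t, is_derive y t (dy t)) -> (forall t, 0 < dy t) ->
  (forall z, exists t, y t = z) ->
  exists tau : R -> R,
    (forall z, y (tau z) = z) /\ (forall t, tau (y t) = t) /\
    (forall z, is_derive tau z (/ dy (tau z))).
Proof.
  intros Hd Hp Hs.
  assert (Hinc : forall s t, s < t -> y s < y t).
  { intros s t Hst. destruct (mvt_open y dy s t Hst) as [c [_ E]].
    - intros; apply Hd.
    - specialize (Hp c). nra. }
  set (tau := fun z => proj1_sig (constructive_indefinite_description _ (Hs z))).
  assert (Ht1 : forall z, y (tau z) = z).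
  { intros z. unfold tau.
    apply (proj2_sig (constructive_indefinite_description _ (Hs z))). }
  assert (Hcan : forall s t, y s < y t -> s < t).
  { intros s t H. destruct (Rtotal_order s t) as [H'|[->|H']].
    - exact H'.
    - lra.
    - apply Hinc in H'. lra. }
  exists tau. split; [exact Ht1|]. split.
  - intros t. destruct (Rtotal_order (tau (y t)) t) as [H|[H|H]];
      [|exact H|]; apply Hinc in H; rewrite Ht1 in H; lra.
  - intros z. apply is_derive_inverse with (f := y).
    + apply Hd.
    + apply Rgt_not_eq, Hp.
    (* By monotonicity, the values of [y] at [tau z - e] and [tau z + e] enclose a neighbourhood of
       [z] that [tau] maps into the tolerance. *)
    + apply eps_continuity_pt. intros e He.
      assert (H1 := Hinc (tau z - e) (tau z) ltac:(lra)).
      assert (H2 := Hinc (tau z) (tau z + e) ltac:(lra)).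
      rewrite Ht1 in H1, H2.
      exists (Rmin (z - y (tau z - e)) (y (tau z + e) - z)).
      split; [apply Rmin_pos; lra|].
      intros z' Hz'.
      assert (Ha := Rlt_le_trans _ _ _ Hz' (Rmin_l _ _)).
      assert (Hb := Rlt_le_trans _ _ _ Hz' (Rmin_r _ _)).
      apply Rabs_def2 in Ha. apply Rabs_def2 in Hb.
      assert (tau z - e < tau z') by (apply Hcan; rewrite Ht1; lra).
      assert (tau z' < tau z + e) by (apply Hcan; rewrite Ht1; lra).
      apply Rabs_def1; lra.
    + exists 1. split; [lra|]. intros; apply Ht1.
Qed.

(** * Functions of two variables *)

Lemma continuity_2d_pt_section1 (f : R -> R -> R) (x y : R) :
  continuity_2d_pt f x y -> continuity_pt (fun z => f z y) x.
Proof.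
  intros H. apply eps_continuity_pt. intros e He.
  destruct (H (mkposreal e He)) as [r Hr].
  exists r. split; [apply cond_pos|]. intros x' Hx'. apply Hr; [exact Hx'|].
  rewrite Rminus_diag, Rabs_R0. apply cond_pos.
Qed.

Lemma continuity_2d_pt_section2 (f : R -> R -> R) (x y : R) :
  continuity_2d_pt f x y -> continuity_pt (fun z => f x z) y.
Proof.
  intros H. apply eps_continuity_pt. intros e He.
  destruct (H (mkposreal e He)) as [r Hr].
  exists r. split; [apply cond_pos|]. intros x' Hx'. apply Hr; [|exact Hx'].
  rewrite Rminus_diag, Rabs_R0. apply cond_pos.
Qed.

Lemma continuity_2d_pt_comp2 (h u v : R -> R -> R) (x y : R) :
  continuity_2d_pt h (u x y) (v x y) ->
  continuity_2d_pt u x y -> continuity_2d_pt v x y ->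
  continuity_2d_pt (fun a b => h (u a b) (v a b)) x y.
Proof.
  intros Hh Hu Hv e. destruct (Hh e) as [r Hr].
  destruct (Hu r) as [r1 H1]. destruct (Hv r) as [r2 H2].
  exists (mkposreal _ (Rmin_stable_in_posreal r1 r2)).
  simpl. intros a b Ha Hb. apply Hr.
  - apply H1; eapply Rlt_le_trans; eauto; apply Rmin_l.
  - apply H2; eapply Rlt_le_trans; eauto; apply Rmin_r.
Qed.

Lemma continuity_pt_curve (h : R -> R -> R) (u v : R -> R) (t : R) :
  continuity_2d_pt h (u t) (v t) -> continuity_pt u t -> continuity_pt v t ->
  continuity_pt (fun s => h (u s) (v s)) t.
Proof.
  intros Hh Hu Hv. apply eps_continuity_pt. intros e He.
  destruct (Hh (mkposreal e He)) as [r Hr].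
  destruct (continuity_pt_eps _ _ Hu r (cond_pos r)) as [r1 [Hr1 H1]].
  destruct (continuity_pt_eps _ _ Hv r (cond_pos r)) as [r2 [Hr2 H2]].
  exists (Rmin r1 r2). split; [now apply Rmin_pos|]. intros s Hs. apply Hr.
  - apply H1. eapply Rlt_le_trans; eauto; apply Rmin_l.
  - apply H2. eapply Rlt_le_trans; eauto; apply Rmin_r.
Qed.

(** One continuous partial derivative and the mere existence of the other at the point already give
    total differentiability: move horizontally at height [b] by the mean value theorem, then
    vertically above [u t] by the definition of the derivative. *)
Lemma is_derive_curve (h hx : R -> R -> R) (u v : R -> R) (t du dv hy : R) :
  locally_2d (fun a b => is_derive (fun z => h z b) a (hx a b)) (u t) (v t) ->
  continuity_2d_pt hx (u t) (v t) ->
  is_derive (fun z => h (u t) z) (v t) hy ->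
  is_derive u t du -> is_derive v t dv ->
  is_derive (fun s => h (u s) (v s)) t (hx (u t) (v t) * du + hy * dv).
Proof.
  intros Hhx Hc Hhy Hu Hv. apply is_derive_Reals.
  apply derivable_pt_lim_comp_2d; try now apply is_derive_Reals.
  destruct Hhx as [r0 Hhx]. intros e.
  destruct (Hc (pos_div_2 e)) as [r1 H1].
  destruct (is_derive_eps _ _ _ Hhy (e / 2)) as [r2 [Hr2 H2]];
    [apply is_pos_div_2|].
  assert (Hr : 0 < Rmin r0 (Rmin r1 r2)).
  { repeat apply Rmin_pos; try apply cond_pos; assumption. }
  exists (mkposreal _ Hr). simpl. intros a b Ha Hb.
  assert (R0 := Rmin_l r0 (Rmin r1 r2)).
  assert (R12 := Rmin_r r0 (Rmin r1 r2)).
  assert (R1' := Rmin_l r1 r2). assert (R2' := Rmin_r r1 r2).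
  destruct (mvt_between (fun z => h z b) (fun z => hx z b) (u t) a)
    as [c [Hc1 Hc2]].
  { intros z Hz. apply Hhx; [|lra].
    apply Rle_lt_trans with (Rabs (a - u t)); [|lra].
    unfold Rmin, Rmax in Hz; destruct (Rle_dec (u t) a); unfold Rabs;
      repeat destruct Rcase_abs; lra. }
  assert (Hca : Rabs (c - u t) <= Rabs (a - u t)).
  { unfold Rmin, Rmax in Hc1; destruct (Rle_dec (u t) a); unfold Rabs;
      repeat destruct Rcase_abs; lra. }
  replace (h a b - h (u t) (v t) -
           (hx (u t) (v t) * (a - u t) + hy * (b - v t)))
    with ((hx c b - hx (u t) (v t)) * (a - u t) +
          (h (u t) b - h (u t) (v t) - hy * (b - v t))) by (simpl in Hc2; lra).
  eapply Rle_trans; [apply Rabs_triang|]. rewrite Rabs_mult.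
  assert (K1 : Rabs (hx c b - hx (u t) (v t)) < e / 2)
    by (apply H1; simpl in *; lra).
  assert (K2 := H2 b ltac:(lra)).
  assert (M1 := Rmax_l (Rabs (a - u t)) (Rabs (b - v t))).
  assert (M2 := Rmax_r (Rabs (a - u t)) (Rabs (b - v t))).
  set (m := Rmax (Rabs (a - u t)) (Rabs (b - v t))) in *.
  assert (P1 := Rabs_pos (a - u t)). assert (P2 := Rabs_pos (b - v t)).
  assert (Pe := cond_pos e).
  assert (Rabs (hx c b - hx (u t) (v t)) * Rabs (a - u t) <= e / 2 * m)
    by (apply Rmult_le_compat; try lra; apply Rabs_pos).
  assert (e / 2 * Rabs (b - v t) <= e / 2 * m)
    by (apply Rmult_le_compat_l; lra).
  lra.
Qed.

(** The radius attached to a point is also kept below [/ (1 + Rabs (f x y))]. A uniform lower bound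
    [m] for the radii, obtained by compactness, thus bounds [f] at the centres by [/ m], and
    elsewhere by [/ m + 1]. *)
Lemma rectangle_bound (f : R -> R -> R) (a b c d : R) :
  (forall x y, a <= x <= b -> c <= y <= d -> continuity_2d_pt f x y) ->
  exists M, 0 < M /\
    forall x y, a <= x <= b -> c <= y <= d -> Rabs (f x y) <= M.
Proof.
  intros Hf.
  assert (Hd : forall x y, exists r : posreal,
            a <= x <= b -> c <= y <= d ->
            r <= / (1 + Rabs (f x y)) /\
            forall u v, Rabs (u - x) < r -> Rabs (v - y) < r ->
              Rabs (f u v - f x y) < 1).
  { intros x y.
    destruct (classic (a <= x <= b /\ c <= y <= d)) as [[Hx Hy]|Hn].
    - destruct (Hf x y Hx Hy (mkposreal 1 Rlt_0_1)) as [r Hr].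
      assert (Hp : 0 < / (1 + Rabs (f x y))).
      { apply Rinv_0_lt_compat. assert (H := Rabs_pos (f x y)). lra. }
      assert (Hm : 0 < Rmin r (/ (1 + Rabs (f x y))))
        by (apply Rmin_pos; [apply cond_pos|exact Hp]).
      exists (mkposreal _ Hm). intros _ _. simpl. split; [apply Rmin_r|].
      intros u v Hu Hv. apply Hr; eapply Rlt_le_trans; eauto; apply Rmin_l.
    - exists (mkposreal 1 Rlt_0_1). intros Hx Hy. tauto. }
  destruct (compactness_value_2d a b c d
    (fun x y => proj1_sig (constructive_indefinite_description _ (Hd x y))))
    as [m Hm].
  exists (/ m + 1). split.
  { assert (0 < / m) by apply Rinv_0_lt_compat, cond_pos. lra. }
  intros x y Hx Hy. apply NNPP. intros Hn. apply (Hm x y Hx Hy).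
  intros [u [v [Hu [Hv [H1 [H2 H3]]]]]]. apply Hn.
  destruct (constructive_indefinite_description _ (Hd u v)) as [r Hr].
  simpl in H1, H2, H3. destruct (Hr Hu Hv) as [Hr1 Hr2].
  specialize (Hr2 x y H1 H2).
  assert (Hpos := Rabs_pos (f u v)).
  assert (1 + Rabs (f u v) <= / m).
  { rewrite <- (Rinv_inv (1 + Rabs (f u v))).
    apply Rinv_le_contravar; [apply cond_pos|lra]. }
  assert (Rabs (f x y) <= Rabs (f u v) + Rabs (f x y - f u v)).
  { replace (f x y) with (f u v + (f x y - f u v)) at 1 by ring.
    apply Rabs_triang. }
  lra.
Qed.

Lemma rectangle_lower_bound (f : R -> R -> R) (a b c d : R) :
  (forall x y, a <= x <= b -> c <= y <= d ->
     continuity_2d_pt f x y /\ 0 < f x y) ->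
  exists m, 0 < m /\ forall x y, a <= x <= b -> c <= y <= d -> m <= f x y.
Proof.
  intros Hf. destruct (rectangle_bound (fun x y => / f x y) a b c d)
    as [M [HM HM']].
  - intros x y Hx Hy. destruct (Hf x y Hx Hy).
    apply continuity_2d_pt_inv; [assumption|lra].
  - exists (/ M). split; [now apply Rinv_0_lt_compat|].
    intros x y Hx Hy. destruct (Hf x y Hx Hy) as [_ Hp].
    specialize (HM' x y Hx Hy).
    assert (Hi := Rinv_0_lt_compat _ Hp).
    rewrite Rabs_right in HM' by lra.
    rewrite <- (Rinv_inv (f x y)). now apply Rinv_le_contravar.
Qed.

Lemma is_derive_RInt_upper (k : R -> R) (a : R) :
  (forall s, continuity_pt k s) ->
  forall y, is_derive (fun z => RInt k a z) y (k y).
Proof.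
  intros Hk y. apply is_derive_RInt with (a := a).
  - apply filter_forall. intros z. apply RInt_correct, ex_RInt_continuous.
    intros s _. apply continuity_pt_filterlim, Hk.
  - apply continuity_pt_filterlim, Hk.
Qed.

Lemma ex_RInt_cont (k : R -> R) (a b : R) :
  (forall s, continuity_pt k s) -> ex_RInt k a b.
Proof.
  intros Hk. apply (ex_RInt_continuous k).
  intros s _. apply continuity_pt_filterlim, Hk.
Qed.

(** The change of the integral splits into that of the integrand over the old range, small by
    uniform continuity, and the piece from [y] to [y'], small because [k] is bounded on a compact
    rectangle. *)
Lemma continuity_2d_RInt (k : R -> R -> R) (lo hi a : R) :
  (forall x s, lo < x < hi -> continuity_2d_pt k x s) ->
  forall x y, lo < x < hi ->
    continuity_2d_pt (fun x y => RInt (k x) a y) x y.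
Proof.
  intros Hk x y Hx e.
  assert (Hk1 : forall x s, lo < x < hi -> continuity_pt (k x) s)
    by (intros; now apply (continuity_2d_pt_section2 k), Hk).
  set (T := Rabs (y - a) + 1).
  assert (HT : 0 < T) by (unfold T; assert (H := Rabs_pos (y - a)); lra).
  set (l := (lo + x) / 2). set (h := (x + hi) / 2).
  assert (Hrect : forall u v, l <= u <= h -> a - T <= v <= a + T ->
            continuity_2d_pt k u v)
    by (intros u v Hu _; apply Hk; unfold l, h in Hu; lra).
  destruct (rectangle_bound k l h (a - T) (a + T) Hrect) as [M [HM HM']].
  assert (He : 0 < e / (4 * T))
    by (apply Rdiv_lt_0_compat; [apply cond_pos|lra]).
  destruct (uniform_continuity_2d k l h (a - T) (a + T) Hrect
              (mkposreal _ He)) as [r Hr].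
  assert (He2 : 0 < e / (4 * M))
    by (apply Rdiv_lt_0_compat; [apply cond_pos|lra]).
  assert (Hrho : 0 < Rmin (Rmin r 1) (Rmin (e / (4 * M)) (Rmin (x - l) (h - x)))).
  { repeat apply Rmin_pos; try apply cond_pos; try assumption;
      unfold l, h; lra. }
  exists (mkposreal _ Hrho). simpl. intros x' y' Hx' Hy'.
  assert (A1 := Rmin_l (Rmin r 1) (Rmin (e / (4 * M)) (Rmin (x - l) (h - x)))).
  assert (A2 := Rmin_r (Rmin r 1) (Rmin (e / (4 * M)) (Rmin (x - l) (h - x)))).
  assert (A3 := Rmin_l r 1). assert (A4 := Rmin_r r 1).
  assert (A5 := Rmin_l (e / (4 * M)) (Rmin (x - l) (h - x))).
  assert (A6 := Rmin_r (e / (4 * M)) (Rmin (x - l) (h - x))).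
  assert (A7 := Rmin_l (x - l) (h - x)). assert (A8 := Rmin_r (x - l) (h - x)).
  set (rho := Rmin (Rmin r 1) _) in *.
  assert (Hxl : l < x' < h).
  { apply Rabs_def2 in Hx'. lra. }
  assert (Hx2 : lo < x' < hi) by (unfold l, h in Hxl; lra).
  assert (HyT : forall s, Rmin a y <= s <= Rmax a y -> a - T <= s <= a + T).
  { intros s Hs. unfold T, Rmin, Rmax in *. destruct (Rle_dec a y);
      unfold Rabs; destruct Rcase_abs; lra. }
  assert (HyT' : forall s, Rmin y y' <= s <= Rmax y y' -> a - T <= s <= a + T).
  { intros s Hs. apply Rabs_def2 in Hy'.
    unfold T, Rmin, Rmax in *. destruct (Rle_dec y y');
      unfold Rabs; destruct Rcase_abs; lra. }
  rewrite <- (RInt_Chasles (k x') a y y')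
    by (apply ex_RInt_cont; intros; apply Hk1; lra).
  (* The mean value theorem for the primitives replaces norm estimates of integrals and treats both
     orders of [a] and [y] at once. *)
  destruct (mvt_between (fun z => RInt (k x') a z - RInt (k x) a z)
              (fun z => k x' z - k x z) a y) as [c [Hc1 Hc2]].
  { intros z _. apply (is_derive_minus (fun z => RInt (k x') a z));
      apply is_derive_RInt_upper; intros; now apply Hk1. }
  rewrite !RInt_point in Hc2.
  destruct (mvt_between (fun z => RInt (k x') y z) (k x') y y') as [c' [Hc3 Hc4]].
  { intros z _. apply is_derive_RInt_upper; intros; now apply Hk1. }
  rewrite RInt_point in Hc4.
  unfold zero in *; unfold plus; simpl in *.
  replace (RInt (k x') a y + RInt (k x') y y' - RInt (k x) a y)
    with ((k x' c - k x c) * (y - a) + k x' c' * (y' - y)) by lra.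
  eapply Rle_lt_trans; [apply Rabs_triang|]. rewrite !Rabs_mult.
  assert (K1 : Rabs (k x' c - k x c) < e / (4 * T)).
  { apply Hr; try (now apply HyT); try lra; try (unfold l, h; lra).
    rewrite Rminus_diag, Rabs_R0. apply cond_pos. }
  assert (K2 : Rabs (k x' c') <= M) by (apply HM'; [lra|now apply HyT']).
  assert (Rabs (k x' c - k x c) * Rabs (y - a) <= e / (4 * T) * T).
  { apply Rmult_le_compat; try apply Rabs_pos; [lra|unfold T; lra]. }
  assert (Rabs (k x' c') * Rabs (y' - y) <= M * (e / (4 * M))).
  { apply Rmult_le_compat; try apply Rabs_pos; lra. }
  replace (e / (4 * T) * T) with (e / 4) in * by (field; lra).
  replace (M * (e / (4 * M))) with (e / 4) in * by (field; lra).
  assert (Hpe := cond_pos e). lra.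
Qed.

(** * Functions of class C^k on an open subset of the plane *)

(* [Ck_plane] with explicit partial derivatives in place of [Derive], so that
   closure properties need no locality argument. *)
Fixpoint smooth_on (k : nat) (U : R -> R -> Prop) (f : R -> R -> R) : Prop :=
  (forall x y, U x y -> continuity_2d_pt f x y) /\
  match k with
  | O => True
  | S k => exists fx fy,
      (forall x y, U x y -> is_derive (fun z => f z y) x (fx x y) /\
                            is_derive (fun z => f x z) y (fy x y)) /\
      smooth_on k U fx /\ smooth_on k U fy
  end.

Lemma smooth_on_cont (k : nat) (U : R -> R -> Prop) (f : R -> R -> R) :
  smooth_on k U f -> forall x y, U x y -> continuity_2d_pt f x y.
Proof. destruct k; intros [H _]; exact H. Qed.

Lemma smooth_on_pred (k : nat) (U : R -> R -> Prop) (f : R -> R -> R) :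
  smooth_on (S k) U f -> smooth_on k U f.
Proof.
  revert f. induction k as [|k IH]; intros f [Hc [fx [fy [Hd [Hx Hy]]]]].
  - now split.
  - split; [exact Hc|]. exists fx, fy. auto.
Qed.

Lemma smooth_on_le (j k : nat) (U : R -> R -> Prop) (f : R -> R -> R) :
  (j <= k)%nat -> smooth_on k U f -> smooth_on j U f.
Proof.
  intros Hjk. induction Hjk as [|k _ IH]; [trivial|].
  intros Hf. now apply IH, smooth_on_pred.
Qed.

Lemma smooth_on_subset (k : nat) (U V : R -> R -> Prop) (f : R -> R -> R) :
  (forall x y, V x y -> U x y) -> smooth_on k U f -> smooth_on k V f.
Proof.
  intros HV. revert f. induction k as [|k IH]; intros f [Hc H].
  - split; auto.
  - destruct H as [fx [fy [Hd [Hx Hy]]]]. split; [auto|].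
    exists fx, fy. split; [|split; now apply IH].
    intros x y Hxy. now apply Hd, HV.
Qed.

Lemma smooth_on_const (k : nat) (U : R -> R -> Prop) (c : R) :
  smooth_on k U (fun _ _ => c).
Proof.
  revert c. induction k as [|k IH]; intros c.
  - split; [|trivial]. intros. apply continuity_2d_pt_const.
  - split; [intros; apply continuity_2d_pt_const|].
    exists (fun _ _ => 0), (fun _ _ => 0).
    split; [|split; apply IH]. split; apply is_derive_Rconst.
Qed.

Lemma smooth_on_plus (k : nat) (U : R -> R -> Prop) (f g : R -> R -> R) :
  smooth_on k U f -> smooth_on k U g -> smooth_on k U (fun x y => f x y + g x y).
Proof.
  revert f g. induction k as [|k IH]; intros f g [Hf Hf'] [Hg Hg'].
  - split; [|trivial]. intros. apply continuity_2d_pt_plus; auto.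
  - split; [intros; apply continuity_2d_pt_plus; auto|].
    destruct Hf' as [fx [fy [Hfd [Hfx Hfy]]]].
    destruct Hg' as [gx [gy [Hgd [Hgx Hgy]]]].
    exists (fun x y => fx x y + gx x y), (fun x y => fy x y + gy x y).
    split; [|auto]. intros x y Hxy.
    destruct (Hfd x y Hxy), (Hgd x y Hxy). split.
    + now apply (is_derive_Rplus (fun z => f z y) (fun z => g z y)).
    + now apply (is_derive_Rplus (fun z => f x z) (fun z => g x z)).
Qed.

Lemma smooth_on_mult (k : nat) (U : R -> R -> Prop) (f g : R -> R -> R) :
  smooth_on k U f -> smooth_on k U g -> smooth_on k U (fun x y => f x y * g x y).
Proof.
  revert f g. induction k as [|k IH]; intros f g HF HG.
  - destruct HF as [Hf _], HG as [Hg _].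
    split; [|trivial]. intros. apply continuity_2d_pt_mult; auto.
  - assert (HF' := smooth_on_pred _ _ _ HF).
    assert (HG' := smooth_on_pred _ _ _ HG).
    destruct HF as [Hf [fx [fy [Hfd [Hfx Hfy]]]]].
    destruct HG as [Hg [gx [gy [Hgd [Hgx Hgy]]]]].
    split; [intros; apply continuity_2d_pt_mult; auto|].
    exists (fun x y => fx x y * g x y + f x y * gx x y),
      (fun x y => fy x y * g x y + f x y * gy x y).
    split; [|split; apply smooth_on_plus; auto]. intros x y Hxy.
    destruct (Hfd x y Hxy), (Hgd x y Hxy). split.
    + now apply (is_derive_Rmult (fun z => f z y) (fun z => g z y)).
    + now apply (is_derive_Rmult (fun z => f x z) (fun z => g x z)).
Qed.

Lemma smooth_on_ext (k : nat) (U : R -> R -> Prop) (f g : R -> R -> R) :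
  (forall x y, U x y -> locally_2d U x y) ->
  (forall x y, U x y -> f x y = g x y) -> smooth_on k U f -> smooth_on k U g.
Proof.
  intros HU Hfg.
  assert (Hc : (forall x y, U x y -> continuity_2d_pt f x y) ->
               forall x y, U x y -> continuity_2d_pt g x y).
  { intros H x y Hxy. apply continuity_2d_pt_ext_loc with f; [|auto].
    destruct (HU x y Hxy) as [r Hr]. exists r. auto. }
  destruct k as [|k].
  - intros [H _]. split; auto.
  - intros [H [fx [fy [Hd [Hx Hy]]]]]. split; [auto|].
    exists fx, fy. split; [|auto]. intros x y Hxy.
    destruct (Hd x y Hxy) as [H1 H2]. destruct (HU x y Hxy) as [r Hr].
    split.
    + apply is_derive_ext_loc with (fun z => f z y); [|exact H1].
      exists r. intros z Hz. apply Hfg, Hr; [exact Hz|].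
      rewrite Rminus_diag, Rabs_R0. apply cond_pos.
    + apply is_derive_ext_loc with (fun z => f x z); [|exact H2].
      exists r. intros z Hz. apply Hfg, Hr; [|exact Hz].
      rewrite Rminus_diag, Rabs_R0. apply cond_pos.
Qed.

Lemma smooth_on_opp (k : nat) (U : R -> R -> Prop) (f : R -> R -> R) :
  (forall x y, U x y -> locally_2d U x y) ->
  smooth_on k U f -> smooth_on k U (fun x y => - f x y).
Proof.
  intros HU Hf. apply smooth_on_ext with (fun x y => -1 * f x y); auto.
  - intros. ring.
  - apply smooth_on_mult; [apply smooth_on_const|exact Hf].
Qed.

(** * Composition with functions of one variable; reciprocal and square root *)

Lemma Derive_n_Derive (j : nat) (f : R -> R) (x : R) :
  Derive_n (Derive f) j x = Derive_n f (S j) x.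
Proof. rewrite <- (Nat.add_1_r j). exact (Derive_n_comp f j 1 x). Qed.

Lemma Ck_line_Derive (k : nat) (V : R -> Prop) (f : R -> R) :
  Ck_line (S k) V f -> Ck_line k V (Derive f).
Proof.
  intros Hf x Hx j Hj.
  destruct (Hf x Hx (S j) ltac:(lia)) as [H1 H2]. split.
  - destruct j as [|j]; [exact I|].
    apply ex_derive_ext with (f := Derive_n f (S j)); [|exact H1].
    intros t. symmetry. apply Derive_n_Derive.
  - apply continuous_ext with (f := Derive_n f (S j)); [|exact H2].
    intros t. symmetry. apply Derive_n_Derive.
Qed.

Lemma smooth_on_comp (k : nat) (U : R -> R -> Prop) (V : R -> Prop)
    (f : R -> R) (w : R -> R -> R) :
  Ck_line k V f -> smooth_on k U w -> (forall x y, U x y -> V (w x y)) ->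
  smooth_on k U (fun x y => f (w x y)).
Proof.
  revert f. induction k as [|k IH]; intros f Hf Hw HV.
  - split; [|trivial]. intros x y Hxy.
    apply (continuity_1d_2d_pt_comp f); [|now apply Hw].
    apply continuity_pt_filterlim. now apply (Hf _ (HV x y Hxy) 0%nat).
  - assert (Hw' := smooth_on_pred _ _ _ Hw).
    destruct Hw as [Hc [wx [wy [Hd [Hx Hy]]]]].
    assert (Hfd : forall x y, U x y -> is_derive f (w x y) (Derive f (w x y))).
    { intros x y Hxy. apply Derive_correct.
      exact (proj1 (Hf _ (HV x y Hxy) 1%nat ltac:(lia))). }
    assert (IHf := IH _ (Ck_line_Derive _ _ _ Hf) Hw' HV).
    split.
    + intros x y Hxy. apply (continuity_1d_2d_pt_comp f); [|now apply Hc].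
      now apply is_derive_continuity_pt with (Derive f (w x y)), Hfd.
    + exists (fun x y => Derive f (w x y) * wx x y),
        (fun x y => Derive f (w x y) * wy x y).
      split; [|split; now apply smooth_on_mult].
      intros x y Hxy. destruct (Hd x y Hxy). split.
      * now apply (is_derive_Rcomp f (fun z => w z y)); [apply Hfd|].
      * now apply (is_derive_Rcomp f (fun z => w x z)); [apply Hfd|].
Qed.

Lemma smooth_on_exp (k : nat) (U : R -> R -> Prop) (w : R -> R -> R) :
  smooth_on k U w -> smooth_on k U (fun x y => exp (w x y)).
Proof.
  intros Hw. apply (smooth_on_comp k U (fun _ => True) exp); auto.
  intros x _ j _.
  assert (E : forall j x, Derive_n exp j x = exp x).
  { clear. induction j as [|j IH]; intros x; [reflexivity|].
    simpl. rewrite (Derive_ext _ exp) by exact IH.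
    apply is_derive_unique, is_derive_Reals, derivable_pt_lim_exp. }
  split.
  - destruct j as [|j]; [exact I|].
    apply (ex_derive_ext exp).
    + intros t. symmetry. apply E.
    + exists (exp x). apply is_derive_Reals, derivable_pt_lim_exp.
  - apply (continuous_ext exp).
    + intros t. symmetry. apply E.
    + apply continuity_pt_filterlim, derivable_continuous_pt, derivable_pt_exp.
Qed.

Lemma smooth_on_inv (k : nat) (U : R -> R -> Prop) (f : R -> R -> R) :
  (forall x y, U x y -> f x y <> 0) ->
  smooth_on k U f -> smooth_on k U (fun x y => / f x y).
Proof.
  intros Hn. induction k as [|k IH]; intros Hf.
  - split; [|trivial]. intros x y Hxy.
    apply continuity_2d_pt_inv; [now apply Hf|auto].
  - assert (IHf := IH (smooth_on_pred _ _ _ Hf)).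
    destruct Hf as [Hc [fx [fy [Hd [Hx Hy]]]]].
    split; [intros; apply continuity_2d_pt_inv; auto|].
    (* The derivative is written as a product involving [/ u], so that the induction hypothesis and
       [smooth_on_mult] apply to it as it stands. *)
    assert (Hdinv : forall (u : R -> R) z l, u z <> 0 -> is_derive u z l ->
              is_derive (fun t => / u t) z (-1 * (l * (/ u z * / u z)))).
    { intros u z l Hu Hl. evar_last.
      - apply (is_derive_inv u z l Hl Hu).
      - simpl. now field. }
    exists (fun x y => -1 * (fx x y * (/ f x y * / f x y))),
      (fun x y => -1 * (fy x y * (/ f x y * / f x y))).
    split.
    + intros x y Hxy. destruct (Hd x y Hxy). split.
      * apply (Hdinv (fun z => f z y)); auto.
      * apply (Hdinv (fun z => f x z)); auto.
    + split; (apply smooth_on_mult; [apply smooth_on_const|];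
        apply smooth_on_mult; [assumption|]; now apply smooth_on_mult).
Qed.

Lemma smooth_on_sqrt (k : nat) (U : R -> R -> Prop) (f : R -> R -> R) :
  (forall x y, U x y -> 0 < f x y) ->
  smooth_on k U f -> smooth_on k U (fun x y => sqrt (f x y)).
Proof.
  intros Hn. induction k as [|k IH]; intros Hf.
  - split; [|trivial]. intros x y Hxy.
    apply (continuity_1d_2d_pt_comp sqrt); [|now apply Hf].
    now apply continuity_pt_sqrt, Rlt_le, Hn.
  - assert (IHf := IH (smooth_on_pred _ _ _ Hf)).
    destruct Hf as [Hc [fx [fy [Hd [Hx Hy]]]]].
    split.
    { intros x y Hxy. apply (continuity_1d_2d_pt_comp sqrt); [|now apply Hc].
      now apply continuity_pt_sqrt, Rlt_le, Hn. }
    assert (Hs : forall x y, U x y -> is_derive sqrt (f x y)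
                   (/ 2 * / sqrt (f x y))).
    { intros x y Hxy. rewrite <- Rinv_mult.
      now apply is_derive_Reals, derivable_pt_lim_sqrt, Hn. }
    exists (fun x y => / 2 * / sqrt (f x y) * fx x y),
      (fun x y => / 2 * / sqrt (f x y) * fy x y).
    split.
    + intros x y Hxy. destruct (Hd x y Hxy). split.
      * now apply (is_derive_Rcomp sqrt (fun z => f z y)); [apply Hs|].
      * now apply (is_derive_Rcomp sqrt (fun z => f x z)); [apply Hs|].
    + assert (smooth_on k U (fun x y => / 2 * / sqrt (f x y))).
      { apply smooth_on_mult; [apply smooth_on_const|].
        apply smooth_on_inv; [|exact IHf].
        intros x y Hxy. apply Rgt_not_eq, sqrt_lt_R0, Hn, Hxy. }
      split; now apply smooth_on_mult.
Qed.

(** * Passage between [smooth_on], [Ck_plane] and the total partial derivatives *)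

Lemma smooth_on_Ck_plane (k : nat) (U : R -> R -> Prop) (f : R -> R -> R) :
  (forall x y, U x y -> locally_2d U x y) ->
  smooth_on k U f -> Ck_plane k U f.
Proof.
  intros HU. revert f. induction k as [|k IH]; intros f Hf x y Hxy.
  - split; [now apply Hf|trivial].
  - destruct Hf as [Hc [fx [fy [Hd [Hx Hy]]]]].
    split; [now apply Hc|].
    split; [exists (fx x y); apply (Hd x y Hxy)|].
    split; [exists (fy x y); apply (Hd x y Hxy)|].
    split.
    + apply (IH (d_x f)); [|exact Hxy].
      apply smooth_on_ext with fx; auto.
      intros u v Huv. symmetry. apply is_derive_unique, (Hd _ _ ltac:(eassumption)).
    + apply (IH (d_y f)); [|exact Hxy].
      apply smooth_on_ext with fy; auto.
      intros u v Huv. symmetry. apply is_derive_unique, (Hd _ _ ltac:(eassumption)).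
Qed.

Lemma Ck_plane_smooth_on (k : nat) (U : R -> R -> Prop) (f : R -> R -> R) :
  Ck_plane k U f -> smooth_on k U f.
Proof.
  revert f. induction k as [|k IH]; intros f Hf.
  - split; [|trivial]. intros x y Hxy. now apply Hf.
  - split; [intros x y Hxy; now apply Hf|].
    exists (d_x f), (d_y f). split.
    + intros x y Hxy. destruct (Hf x y Hxy) as [_ [H1 [H2 _]]].
      split; now apply Derive_correct.
    + split; apply IH; intros x y Hxy; now apply Hf.
Qed.

Lemma smooth_on_d_x (k : nat) (U : R -> R -> Prop) (f : R -> R -> R) :
  (forall x y, U x y -> locally_2d U x y) ->
  smooth_on (S k) U f ->
  smooth_on k U (d_x f) /\
  forall x y, U x y -> is_derive (fun z => f z y) x (d_x f x y).
Proof.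
  intros HU [_ [fx [fy [Hd [Hx _]]]]]. split.
  - apply smooth_on_ext with fx; auto.
    intros x y Hxy. symmetry. apply is_derive_unique, (Hd _ _ ltac:(eassumption)).
  - intros x y Hxy. apply Derive_correct. exists (fx x y). apply (Hd x y Hxy).
Qed.

Lemma smooth_on_d_y (k : nat) (U : R -> R -> Prop) (f : R -> R -> R) :
  (forall x y, U x y -> locally_2d U x y) ->
  smooth_on (S k) U f ->
  smooth_on k U (d_y f) /\
  forall x y, U x y -> is_derive (fun z => f x z) y (d_y f x y).
Proof.
  intros HU [_ [fx [fy [Hd [_ Hy]]]]]. split.
  - apply smooth_on_ext with fy; auto.
    intros x y Hxy. symmetry. apply is_derive_unique, (Hd _ _ ltac:(eassumption)).
  - intros x y Hxy. apply Derive_correct. exists (fy x y). apply (Hd x y Hxy).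
Qed.

Lemma smooth_on_derive_curve (U : R -> R -> Prop) (f : R -> R -> R)
    (u v : R -> R) (t du dv : R) :
  (forall x y, U x y -> locally_2d U x y) ->
  smooth_on 1 U f -> U (u t) (v t) -> is_derive u t du -> is_derive v t dv ->
  is_derive (fun s => f (u s) (v s)) t
    (d_x f (u t) (v t) * du + d_y f (u t) (v t) * dv).
Proof.
  intros HU Hf Ht Hu Hv.
  destruct (smooth_on_d_x 0 U f HU Hf) as [Hx Hdx].
  destruct (smooth_on_d_y 0 U f HU Hf) as [_ Hdy].
  apply (is_derive_curve f (d_x f)); auto.
  - destruct (HU _ _ Ht) as [r Hr]. exists r. auto.
  - now apply Hx.
Qed.

(** * Global behaviour of the trajectories *)

Lemma is_derive_reflection (t : R) : is_derive (fun s => - s) t (-1).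
Proof. auto_derive; [trivial|ring]. Qed.

(** While the trajectory stays in the strip it rises above [y0], where the field points left; so it
    never approaches [x = m]. Only the wall [x = 0] could stop it, and the bound of [bx] by a
    multiple of [x] excludes that. *)
Lemma forward_trajectory (bx by_ : R -> R -> R) (m y0 : R) (xx yy : R -> R) :
  (forall x y, 0 < x < m -> y0 < y -> bx x y < 0) ->
  (forall x y, 0 < x < m -> 0 < by_ x y) ->
  (forall a T, 0 < a < m -> exists M, forall x y,
     0 <= x <= a -> Rabs (y - y0) <= T -> Rabs (bx x y) <= M * x) ->
  (forall a T, 0 < a < m -> exists c, 0 < c /\ forall x y,
     0 < x <= a -> Rabs (y - y0) <= T -> c <= by_ x y) ->
  (forall t, is_derive xx t (bx (xx t) (yy t))) ->
  (forall t, is_derive yy t (by_ (xx t) (yy t))) ->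
  0 < xx 0 < m -> yy 0 = y0 ->
  (forall t, 0 <= t -> 0 < xx t <= xx 0) /\
  (forall Y, exists t, 0 <= t /\ Y <= yy t).
Proof.
  intros Hneg Hpos Hbd Hlow Hx Hy Hx0 Hy0.
  assert (Hinc : forall t, 0 < t -> (forall s, 0 <= s < t -> 0 < xx s < m) ->
            forall r s, 0 <= r -> r < s -> s <= t -> yy r < yy s).
  { intros t Ht Hin r s Hr Hrs Hst.
    destruct (mvt_open yy _ r s Hrs (fun z _ => Hy z)) as [c [Hc E]].
    assert (0 < by_ (xx c) (yy c)) by (apply Hpos, Hin; lra). nra. }
  assert (Hdec : forall t, 0 < t -> (forall s, 0 <= s < t -> 0 < xx s < m) ->
            forall s, 0 <= s <= t -> xx s <= xx 0).
  { intros t Ht Hin s Hs. destruct (Req_dec s 0) as [->|Hs0]; [lra|].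
    destruct (mvt_open xx _ 0 s ltac:(lra) (fun z _ => Hx z)) as [c [Hc E]].
    assert (bx (xx c) (yy c) < 0).
    { apply Hneg; [apply Hin; lra|]. rewrite <- Hy0.
      apply (Hinc t); auto; lra. }
    nra. }
  assert (Hin : forall t, 0 <= t -> 0 < xx t < m).
  { apply forward_induction.
    - exact Hx0.
    - intros t _ Ht.
      destruct (continuity_pt_eps xx t (is_derive_continuity_pt _ _ _ (Hx t))
        (Rmin (xx t) (m - xx t))) as [r [Hr H]]; [apply Rmin_pos; lra|].
      exists r. split; [exact Hr|]. intros s Hs. specialize (H s Hs).
      assert (A := Rmin_l (xx t) (m - xx t)).
      assert (B := Rmin_r (xx t) (m - xx t)).
      apply Rabs_def2 in H. lra.
    - intros t Ht Hlt.
      assert (Hle := Hdec t Ht Hlt t ltac:(lra)).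
      assert (Hge : 0 <= xx t).
      { apply Rnot_lt_le. intros Hn.
        destruct (continuity_pt_eps xx t
          (is_derive_continuity_pt _ _ _ (Hx t)) (- xx t)) as [r [Hr H]]; [lra|].
        assert (Hm := Rmin_pos r t Hr Ht).
        assert (Rmin r t <= r) by apply Rmin_l.
        assert (Rmin r t <= t) by apply Rmin_r.
        specialize (H (t - Rmin r t / 2)).
        assert (Ha : Rabs (t - Rmin r t / 2 - t) < r)
          by (apply Rabs_def1; lra).
        specialize (H Ha). apply Rabs_def2 in H.
        specialize (Hlt (t - Rmin r t / 2) ltac:(lra)). lra. }
      (* A trajectory on the wall at time [t] would, by Gronwall backwards in time, have been there
         at time [0]. On [[0, t]] the heights lie between [y0] and [yy t], which fixes the constant
         [M]. *)
      destruct (Req_dec (xx t) 0) as [H0|H0]; [|lra]. exfalso.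
      destruct (Hbd (xx 0) (yy t - y0) Hx0) as [M HM].
      assert (xx 0 = 0); [|lra].
      apply (gronwall_zero xx (fun s => bx (xx s) (yy s)) M 0 t t); try lra.
      + intros s _. apply Hx.
      + intros s Hs.
        assert (Hs0 : 0 <= xx s).
        { destruct (Req_dec s t) as [->|Hst]; [exact Hge|].
          apply Rlt_le, Hlt. lra. }
        rewrite (Rabs_right (xx s)) by lra. apply HM.
        * split; [exact Hs0|]. now apply (Hdec t).
        * assert (y0 <= yy s).
          { destruct (Req_dec s 0) as [->|]; [lra|].
            rewrite <- Hy0. apply Rlt_le, (Hinc t); auto; lra. }
          assert (yy s <= yy t).
          { destruct (Req_dec s t) as [->|]; [lra|].
            apply Rlt_le, (Hinc t); auto; lra. }
          rewrite Rabs_right; lra. }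
  assert (Hle : forall t, 0 <= t -> xx t <= xx 0).
  { intros t Ht. apply (Hdec (t + 1)); try lra. intros s Hs. apply Hin. lra. }
  split.
  - intros t Ht. split; [now apply Hin|now apply Hle].
  - intros Y. destruct (Rle_lt_dec Y y0) as [HY|HY].
    { exists 0. lra. }
    apply NNPP. intros Hn.
    assert (Hlt : forall t, 0 <= t -> yy t < Y).
    { intros t Ht. apply Rnot_le_lt. intros H. apply Hn. now exists t. }
    (* Below height [Y] the vertical speed is at least [c], so the time [(Y - y0) / c] would be
       enough to reach [Y]. *)
    destruct (Hlow (xx 0) (Y - y0) Hx0) as [c [Hc Hc']].
    assert (HT : 0 < (Y - y0) / c) by (apply Rdiv_lt_0_compat; lra).
    destruct (mvt_open yy _ 0 _ HT (fun z _ => Hy z)) as [s [Hs E]].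
    assert (Hys : y0 <= yy s).
    { rewrite <- Hy0. apply Rlt_le, (Hinc (s + 1)); try lra.
      intros r Hr. apply Hin. lra. }
    assert (c <= by_ (xx s) (yy s)).
    { apply Hc'.
      - split; [apply Hin|apply Hle]; lra.
      - rewrite Rabs_right by lra. specialize (Hlt s ltac:(lra)). lra. }
    specialize (Hlt _ (Rlt_le _ _ HT)).
    assert (c * ((Y - y0) / c) = Y - y0) by (field; lra).
    rewrite Hy0 in E. nra.
Qed.

Lemma global_trajectory (bx by_ : R -> R -> R) (m y0 : R) (xx yy : R -> R) :
  (forall x y, 0 < x < m -> y0 < y -> bx x y < 0) ->
  (forall x y, 0 < x < m -> y < y0 -> 0 < bx x y) ->
  (forall x y, 0 < x < m -> 0 < by_ x y) ->
  (forall a T, 0 < a < m -> exists M, forall x y,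
     0 <= x <= a -> Rabs (y - y0) <= T -> Rabs (bx x y) <= M * x) ->
  (forall a T, 0 < a < m -> exists c, 0 < c /\ forall x y,
     0 < x <= a -> Rabs (y - y0) <= T -> c <= by_ x y) ->
  (forall t, is_derive xx t (bx (xx t) (yy t))) ->
  (forall t, is_derive yy t (by_ (xx t) (yy t))) ->
  0 < xx 0 < m -> yy 0 = y0 ->
  (forall t, 0 < xx t <= xx 0) /\ (forall Y, exists t, yy t = Y).
Proof.
  intros Hup Hdown Hpos Hbd Hlow Hx Hy Hx0 Hy0.
  destruct (forward_trajectory bx by_ m y0 xx yy) as [F1 F2]; auto.
  (* The backward half is the forward half for the field reflected in [y = y0]. *)
  destruct (forward_trajectory (fun x y => - bx x (2 * y0 - y))
              (fun x y => by_ x (2 * y0 - y)) m y0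
              (fun t => xx (- t)) (fun t => 2 * y0 - yy (- t)))
    as [B1 B2].
  - intros x y Hxm Hyl. assert (0 < bx x (2 * y0 - y)) by (apply Hdown; lra). lra.
  - intros x y Hxm. now apply Hpos.
  - intros a T Ha. destruct (Hbd a T Ha) as [M HM]. exists M.
    intros x y Hxa HyT. rewrite Rabs_Ropp. apply HM; [exact Hxa|].
    replace (2 * y0 - y - y0) with (- (y - y0)) by ring. now rewrite Rabs_Ropp.
  - intros a T Ha. destruct (Hlow a T Ha) as [c [Hc HM]]. exists c.
    split; [exact Hc|]. intros x y Hxa HyT. apply HM; [exact Hxa|].
    replace (2 * y0 - y - y0) with (- (y - y0)) by ring. now rewrite Rabs_Ropp.
  - intros t. assert (H := Hx (- t)).
    replace (2 * y0 - (2 * y0 - yy (- t))) with (yy (- t)) by ring.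
    evar_last.
    + apply (is_derive_Rcomp xx (fun t => - t)); [exact H|].
      apply is_derive_reflection.
    + ring.
  - intros t. assert (H := Hy (- t)).
    replace (2 * y0 - (2 * y0 - yy (- t))) with (yy (- t)) by ring.
    evar_last.
    + apply (is_derive_minus (fun _ => 2 * y0) (fun t => yy (- t))).
      * apply (is_derive_const (2 * y0)).
      * apply (is_derive_Rcomp yy (fun t => - t)); [exact H|].
        apply is_derive_reflection.
    + unfold minus, plus, opp, zero; simpl. ring.
  - now rewrite Ropp_0.
  - rewrite Ropp_0, Hy0. ring.
  - split.
    + intros t. destruct (Rle_lt_dec 0 t) as [Ht|Ht]; [now apply F1|].
      specialize (B1 (- t) ltac:(lra)). now rewrite Ropp_involutive, Ropp_0 in B1.
    + intros Y. destruct (F2 Y) as [t [Ht HtY]].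
      (* A reflected height of at least [2 * y0 - Y] means [yy (- s) <= Y]. *)
      destruct (B2 (2 * y0 - Y)) as [s [Hs HsY]].
      destruct (IVT_gen yy (- s) t Y) as [r [_ Hr]].
      * intros z. eapply is_derive_continuity_pt, Hy.
      * assert (Rmin (yy (- s)) (yy t) <= yy (- s)) by apply Rmin_l.
        assert (yy t <= Rmax (yy (- s)) (yy t)) by apply Rmax_r. lra.
      * now exists r.
Qed.

Lemma trajectory_graph (bx by_ : R -> R -> R) (m y0 : R) (xx yy : R -> R) :
  (forall x y, 0 < x < m -> y0 < y -> bx x y < 0) ->
  (forall x y, 0 < x < m -> y < y0 -> 0 < bx x y) ->
  (forall x y, 0 < x < m -> 0 < by_ x y) ->
  (forall a T, 0 < a < m -> exists M, forall x y,
     0 <= x <= a -> Rabs (y - y0) <= T -> Rabs (bx x y) <= M * x) ->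
  (forall a T, 0 < a < m -> exists c, 0 < c /\ forall x y,
     0 < x <= a -> Rabs (y - y0) <= T -> c <= by_ x y) ->
  (forall t, is_derive xx t (bx (xx t) (yy t))) ->
  (forall t, is_derive yy t (by_ (xx t) (yy t))) ->
  0 < xx 0 < m -> yy 0 = y0 ->
  exists tau : R -> R,
    (forall z, yy (tau z) = z) /\ (forall t, tau (yy t) = t) /\
    (forall t, 0 < xx t <= xx 0) /\
    (forall z, is_derive (fun z => xx (tau z)) z
                 (bx (xx (tau z)) z / by_ (xx (tau z)) z)).
Proof.
  intros Hup Hdown Hpos Hbd Hlow Hx Hy Hx0 Hy0.
  destruct (global_trajectory bx by_ m y0 xx yy) as [Hr Hs]; auto.
  destruct (increasing_bijection_inverse yy (fun t => by_ (xx t) (yy t)))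
    as [tau [T1 [T2 T3]]]; auto.
  { intros t. apply Hpos. specialize (Hr t). lra. }
  exists tau. split; [exact T1|split; [exact T2|split; [exact Hr|]]].
  intros z. evar_last.
  - apply (is_derive_Rcomp xx tau); [apply Hx|apply T3].
  - rewrite !T1. reflexivity.
Qed.

(** * The flow of a scalar equation *)

Section ScalarFlow.

(** These become [d / 2], [alpha] and [L / 2], with [X] extracted from the given flow rather than
    constructed. Trajectories may come arbitrarily close to the wall [x = 0]; continuity of [gx] up
    to it gives bounds on compact rectangles that contain them. *)
Variables (m a y0 : R) (g gx X : R -> R -> R).
Hypothesis a_range : 0 < a < m.
Hypothesis g_derive : forall x y, 0 < x < m ->
  is_derive (fun z => g z y) x (gx x y).
Hypothesis gx_cont : forall x y, 0 <= x < m -> continuity_2d_pt gx x y.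
Hypothesis X_start : forall x, 0 < x < m -> X x y0 = x.
Hypothesis X_ode : forall x y, 0 < x < m -> is_derive (X x) y (g (X x y) y).
Hypothesis X_range : forall x y, 0 < x < m -> 0 < X x y <= x.

Lemma g_mvt (c u v y : R) :
  0 < u <= c -> 0 < v <= c -> c < m ->
  exists xi, Rmin u v <= xi <= Rmax u v /\ g v y - g u y = gx xi y * (v - u).
Proof.
  intros Hu Hv Hc. apply (mvt_between (fun z => g z y) (fun z => gx z y)).
  intros z Hz. apply g_derive.
  unfold Rmin, Rmax in Hz. destruct (Rle_dec u v); lra.
Qed.

Lemma gx_bound (c T : R) : c < m ->
  exists M, 0 < M /\ forall x y, 0 <= x <= c -> Rabs (y - y0) <= T ->
    Rabs (gx x y) <= M.
Proof.
  intros Hc. destruct (rectangle_bound gx 0 c (y0 - T) (y0 + T)) as [M [HM H]].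
  - intros x y Hx _. apply gx_cont. lra.
  - exists M. split; [exact HM|]. intros x y Hx Hy. apply H; [exact Hx|].
    apply Rabs_le_between in Hy. lra.
Qed.

Lemma X_diff_derive (x1 x2 y : R) : 0 < x1 < m -> 0 < x2 < m ->
  is_derive (fun s => X x2 s - X x1 s) y (g (X x2 y) y - g (X x1 y) y).
Proof.
  intros H1 H2. apply (is_derive_minus (X x2) (X x1)); now apply X_ode.
Qed.

Lemma X_cont_y (x y : R) : 0 < x < m -> continuity_pt (X x) y.
Proof. intros Hx. eapply is_derive_continuity_pt. now apply X_ode. Qed.

(** By Gronwall the gap between two trajectories vanishes nowhere, since it does not vanish at [y0];
    by the intermediate value theorem it keeps its initial sign. *)
Lemma X_lt (x1 x2 y : R) : 0 < x1 -> x1 < x2 -> x2 < m -> X x1 y < X x2 y.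
Proof.
  intros H1 H12 H2.
  assert (Hne : forall s, X x2 s - X x1 s <> 0).
  { intros s E. destruct (gx_bound x2 (Rabs (s - y0)) H2) as [M [_ HM]].
    assert (X x2 y0 - X x1 y0 = 0); [|rewrite !X_start in H; lra].
    apply (gronwall_zero (fun s => X x2 s - X x1 s)
             (fun s => g (X x2 s) s - g (X x1 s) s) M
             (y0 - Rabs (s - y0)) (y0 + Rabs (s - y0)) s).
    - intros t _. apply X_diff_derive; lra.
    - intros t Ht.
      assert (R1 := X_range x1 t ltac:(lra)).
      assert (R2 := X_range x2 t ltac:(lra)).
      destruct (g_mvt x2 (X x1 t) (X x2 t) t) as [xi [Hxi ->]]; try lra.
      rewrite Rabs_mult. apply Rmult_le_compat_r; [apply Rabs_pos|].
      apply HM.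
      + unfold Rmin, Rmax in Hxi. destruct (Rle_dec (X x1 t) (X x2 t)); lra.
      + apply Rabs_le_between. lra.
    - unfold Rabs; destruct Rcase_abs; lra.
    - exact E.
    - assert (H := Rabs_pos (s - y0)). lra. }
  destruct (Rlt_le_dec (X x1 y) (X x2 y)) as [H|H]; [exact H|].
  destruct (IVT_gen (fun s => X x2 s - X x1 s) y0 y 0) as [s [_ Hs]].
  - intros s. eapply is_derive_continuity_pt. apply X_diff_derive; lra.
  - simpl. rewrite !X_start by lra.
    unfold Rmin, Rmax. destruct (Rle_dec (x2 - x1) (X x2 y - X x1 y)); lra.
  - now destruct (Hne s).
Qed.

(* [A] is the integral of the difference quotients of [g] between the two
   trajectories; it is compared with any function [C] whose derivative is
   close to these quotients. *)
Lemma X_difference (x1 x2 y e : R) (C c : R -> R) :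
  0 < x1 < m -> 0 < x2 < m -> x1 <> x2 ->
  (forall s, is_derive C s (c s)) -> C y0 = 0 ->
  (forall s xi, Rabs (s - y0) <= Rabs (y - y0) ->
     Rmin (X x1 s) (X x2 s) <= xi <= Rmax (X x1 s) (X x2 s) ->
     Rabs (gx xi s - c s) <= e) ->
  exists A, X x2 y - X x1 y = exp A * (x2 - x1) /\
            Rabs (A - C y) <= e * Rabs (y - y0).
Proof.
  intros H1 H2 Hne HC HC0 Hc.
  set (q := fun s => (X x2 s - X x1 s) / (x2 - x1)).
  assert (Hq : forall s, 0 < q s).
  { intros s. unfold q. destruct (Rlt_le_dec x1 x2) as [H|H].
    - assert (H' := X_lt x1 x2 s ltac:(lra) H ltac:(lra)).
      apply Rdiv_lt_0_compat; lra.
    - assert (H' := X_lt x2 x1 s ltac:(lra) ltac:(lra) ltac:(lra)).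
      replace ((X x2 s - X x1 s) / (x2 - x1))
        with ((X x1 s - X x2 s) / (x1 - x2)) by (field; lra).
      apply Rdiv_lt_0_compat; lra. }
  assert (Hdq : forall s, is_derive q s
                  ((g (X x2 s) s - g (X x1 s) s) / (x2 - x1))).
  { intros s. unfold q, Rdiv.
    evar_last.
    - apply (is_derive_Rmult (fun s => X x2 s - X x1 s)).
      + now apply X_diff_derive.
      + apply is_derive_Rconst.
    - simpl. unfold Rdiv. ring. }
  (* [q] is the gap relative to its initial value; its logarithm has as derivative the difference
     quotient of [g], which is a value of [gx] between the two trajectories. *)
  assert (Hd : forall s, is_derive (fun s => ln (q s) - C s) s
                 ((g (X x2 s) s - g (X x1 s) s) / (X x2 s - X x1 s) - c s)).
  { intros s. apply (is_derive_minus (fun s => ln (q s))); [|apply HC].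
    evar_last.
    - apply (is_derive_Rcomp ln q); [|apply Hdq].
      apply is_derive_Reals, derivable_pt_lim_ln, Hq.
    - specialize (Hq s). unfold q in *.
      assert (X x2 s - X x1 s <> 0).
      { intros E. rewrite E in Hq. unfold Rdiv in Hq. lra. }
      field. split; lra. }
  exists (ln (q y)). split.
  { rewrite exp_ln by apply Hq. unfold q. field. lra. }
  destruct (mvt_between (fun s => ln (q s) - C s) _ y0 y (fun s _ => Hd s))
    as [s [Hs E]].
  assert (Hq0 : q y0 = 1) by (unfold q; rewrite !X_start by lra; field; lra).
  simpl in E. rewrite Hq0, ln_1, HC0 in E.
  replace (ln (q y) - C y) with (ln (q y) - C y - (0 - 0)) by ring.
  rewrite E, Rabs_mult. apply Rmult_le_compat_r; [apply Rabs_pos|].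
  assert (R1 := X_range x1 s H1). assert (R2 := X_range x2 s H2).
  destruct (g_mvt (Rmax x1 x2) (X x1 s) (X x2 s) s) as [xi [Hxi Exi]].
  - assert (H := Rmax_l x1 x2). lra.
  - assert (H := Rmax_r x1 x2). lra.
  - apply Rmax_lub_lt; lra.
  - rewrite Exi. specialize (Hq s). unfold q in Hq.
    assert (X x2 s - X x1 s <> 0).
    { intros E'. rewrite E' in Hq. unfold Rdiv in Hq. lra. }
    replace (gx xi s * (X x2 s - X x1 s) / (X x2 s - X x1 s))
      with (gx xi s) by (now field).
    apply Hc; [|exact Hxi].
    unfold Rmin, Rmax in Hs; destruct (Rle_dec y0 y); unfold Rabs;
      repeat destruct Rcase_abs; lra.
Qed.

Lemma X_lipschitz (c T : R) : c < m ->
  exists K, 0 < K /\ forall x1 x2 y, 0 < x1 <= c -> 0 < x2 <= c ->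
    Rabs (y - y0) <= T -> Rabs (X x2 y - X x1 y) <= K * Rabs (x2 - x1).
Proof.
  intros Hc. destruct (gx_bound c T Hc) as [M [HM HM']].
  exists (exp (M * T)). split; [apply exp_pos|].
  intros x1 x2 y H1 H2 Hy.
  destruct (Req_dec x1 x2) as [<-|Hne].
  { rewrite !Rminus_diag, Rabs_R0. lra. }
  (* Compared with [C = 0], a bound [M] of [gx] becomes the bound [M * T] of the exponent. *)
  destruct (X_difference x1 x2 y M (fun _ => 0) (fun _ => 0))
    as [A [HA HA']]; try lra.
  - intros s. apply (is_derive_const 0).
  - intros s xi Hs Hxi. rewrite Rminus_0_r. apply HM'; [|lra].
    assert (R1 := X_range x1 s ltac:(lra)).
    assert (R2 := X_range x2 s ltac:(lra)).
    unfold Rmin, Rmax in Hxi. destruct (Rle_dec (X x1 s) (X x2 s)); lra.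
  - rewrite HA, Rabs_mult. apply Rmult_le_compat_r; [apply Rabs_pos|].
    rewrite Rabs_right by (apply Rle_ge, Rlt_le, exp_pos).
    assert (HAT : A <= M * T).
    { rewrite Rminus_0_r in HA'. assert (H := Rle_abs A). nra. }
    destruct HAT as [HAT|<-]; [|lra]. now apply Rlt_le, exp_increasing.
Qed.

(** A Lipschitz constant in [x], uniform for bounded heights, is combined with continuity in the
    height. *)
Lemma X_cont (x y : R) : 0 < x < m -> continuity_2d_pt X x y.
Proof.
  intros Hx e.
  destruct (X_lipschitz ((x + m) / 2) (Rabs (y - y0) + 1) ltac:(lra))
    as [K [HK HK']].
  assert (He : 0 < e / 2) by apply is_pos_div_2.
  destruct (continuity_pt_eps _ _ (X_cont_y x y Hx) _ He) as [r [Hr Hr']].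
  assert (HeK : 0 < e / 2 / K) by now apply Rdiv_lt_0_compat.
  assert (Hrho : 0 < Rmin (Rmin r 1) (Rmin (e / 2 / K) (Rmin x ((m - x) / 2)))).
  { repeat apply Rmin_pos; lra. }
  exists (mkposreal _ Hrho). simpl. intros x' y' Hx' Hy'.
  assert (A1 := Rmin_l (Rmin r 1) (Rmin (e / 2 / K) (Rmin x ((m - x) / 2)))).
  assert (A2 := Rmin_r (Rmin r 1) (Rmin (e / 2 / K) (Rmin x ((m - x) / 2)))).
  assert (A3 := Rmin_l r 1). assert (A4 := Rmin_r r 1).
  assert (A5 := Rmin_l (e / 2 / K) (Rmin x ((m - x) / 2))).
  assert (A6 := Rmin_r (e / 2 / K) (Rmin x ((m - x) / 2))).
  assert (A7 := Rmin_l x ((m - x) / 2)). assert (A8 := Rmin_r x ((m - x) / 2)).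
  set (rho := Rmin (Rmin r 1) _) in *.
  assert (B1 := Rabs_def2 _ _ Hx').
  assert (Hy1 : Rabs (y' - y0) <= Rabs (y - y0) + 1).
  { replace (y' - y0) with ((y - y0) + (y' - y)) by ring.
    eapply Rle_trans; [apply Rabs_triang|]. lra. }
  assert (L := HK' x x' y' ltac:(lra) ltac:(lra) Hy1).
  specialize (Hr' y' ltac:(lra)).
  replace (X x' y' - X x y) with ((X x' y' - X x y') + (X x y' - X x y)) by ring.
  eapply Rle_lt_trans; [apply Rabs_triang|].
  assert (K * Rabs (x' - x) <= K * (e / 2 / K))
    by (apply Rmult_le_compat_l; lra).
  replace (K * (e / 2 / K)) with (e / 2) in * by (field; lra). lra.
Qed.

Lemma along_cont (U : R -> R -> Prop) (h : R -> R -> R) (b : R) :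
  b <= m -> (forall x y, 0 < x < b -> U (X x y) y) ->
  (forall x y, U x y -> continuity_2d_pt h x y) ->
  forall x y, 0 < x < b -> continuity_2d_pt (fun x y => h (X x y) y) x y.
Proof.
  intros Hb HU Hh x y Hx.
  apply (continuity_2d_pt_comp2 h X (fun _ y => y)).
  - now apply Hh, HU.
  - apply X_cont. lra.
  - apply continuity_2d_pt_id2.
Qed.

Definition X_jac (x y : R) : R := exp (RInt (fun s => gx (X x s) s) y0 y).

Lemma gx_along_cont (x y : R) : 0 < x < m ->
  continuity_2d_pt (fun x y => gx (X x y) y) x y.
Proof.
  apply (along_cont (fun x _ => 0 < x < m) gx m); [lra| |].
  - intros u v Hu. specialize (X_range u v Hu). lra.
  - intros u v Hu. apply gx_cont. lra.
Qed.

Lemma X_jac_cont (x y : R) : 0 < x < m -> continuity_2d_pt X_jac x y.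
Proof.
  intros Hx. apply (continuity_1d_2d_pt_comp exp).
  - apply derivable_continuous_pt, derivable_pt_exp.
  - apply continuity_2d_RInt with (lo := 0) (hi := m); [|exact Hx].
    apply gx_along_cont.
Qed.

(** The slope between [x] and [x'] is [exp A] by [X_difference]. As [x'] tends to [x] the two
    trajectories become uniformly close, and uniform continuity of [gx] makes [A] tend to the
    integral in [X_jac]. *)
Lemma X_derive (x y : R) : 0 < x < m ->
  is_derive (fun z => X z y) x (X_jac x y).
Proof.
  intros Hx. apply is_derive_slope. intros e He.
  set (C := fun y => RInt (fun s => gx (X x s) s) y0 y).
  assert (HC : forall s, is_derive C s (gx (X x s) s)).
  { intros s. apply (is_derive_RInt_upper (fun s => gx (X x s) s)).
    intros t. apply (continuity_2d_pt_section2 (fun x y => gx (X x y) y)).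
    now apply gx_along_cont. }
  assert (HC0 : C y0 = 0) by apply (RInt_point y0 (fun s => gx (X x s) s)).
  set (T := Rabs (y - y0)). assert (HT : 0 <= T) by apply Rabs_pos.
  destruct (continuity_pt_eps exp (C y)
    (derivable_continuous_pt _ _ (derivable_pt_exp (C y))) e He)
    as [e1 [He1 He1']].
  (* The exponents differ by at most this number times [T]; [T + 1] makes that strictly less than
     [e1], also when [T = 0]. *)
  assert (He2 : 0 < e1 / (T + 1)) by (apply Rdiv_lt_0_compat; lra).
  set (c := (x + m) / 2).
  destruct (uniform_continuity_2d gx 0 c (y0 - T) (y0 + T)) with
    (eps := mkposreal _ He2) as [r Hr].
  { intros u v Hu _. apply gx_cont. unfold c in Hu. lra. }
  destruct (X_lipschitz c T) as [K [HK HK']]; [unfold c; lra|].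
  assert (HrK : 0 < r / K) by (apply Rdiv_lt_0_compat; [apply cond_pos|lra]).
  exists (Rmin (r / K) (Rmin x ((m - x) / 2))).
  split; [repeat apply Rmin_pos; lra|].
  intros x' Hx' Hne.
  assert (A1 := Rmin_l (r / K) (Rmin x ((m - x) / 2))).
  assert (A2 := Rmin_r (r / K) (Rmin x ((m - x) / 2))).
  assert (A3 := Rmin_l x ((m - x) / 2)). assert (A4 := Rmin_r x ((m - x) / 2)).
  assert (Hxx := Rabs_def2 _ _ Hx').
  assert (Hc1 : 0 < x' <= c) by (unfold c; lra).
  assert (Hc2 : 0 < x <= c) by (unfold c; lra).
  assert (Hcm : c < m) by (unfold c; lra).
  destruct (X_difference x x' y (e1 / (T + 1)) C (fun s => gx (X x s) s))
    as [A [HA HA']]; auto; try lra.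
  - intros s xi Hs Hxi. fold T in Hs.
    assert (R1 := X_range x s ltac:(lra)).
    assert (R2 := X_range x' s ltac:(lra)).
    assert (Hs' := proj1 (Rabs_le_between _ _) Hs).
    left. apply Hr; try lra.
    + unfold Rmin, Rmax in Hxi. destruct (Rle_dec (X x s) (X x' s)); lra.
    + apply Rle_lt_trans with (Rabs (X x' s - X x s)).
      * unfold Rmin, Rmax in Hxi. destruct (Rle_dec (X x s) (X x' s));
          unfold Rabs; repeat destruct Rcase_abs; lra.
      * apply Rle_lt_trans with (K * Rabs (x' - x)); [now apply HK'|].
        replace (pos r) with (K * (r / K)) by (field; lra).
        apply Rmult_lt_compat_l; lra.
    + rewrite Rminus_diag, Rabs_R0. apply cond_pos.
  - exists (exp A). split; [exact HA|]. apply He1'.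
    apply Rle_lt_trans with (1 := HA'). fold T.
    apply Rlt_le_trans with (e1 / (T + 1) * (T + 1)).
    + apply Rmult_lt_compat_l; lra.
    + right. field. lra.
Qed.

(** * The region swept by the trajectories and its projection along them *)

(** This is [D_region] without time: the heights of the bounding trajectory fill the line. *)
Definition X_region (x y : R) : Prop := 0 < x < X a y.

(* [foot x y] is the abscissa at height [y0] of the trajectory through [(x, y)],
   inside [X_region] (outside, [epsilon] is unspecified). *)
Definition foot (x y : R) : R :=
  epsilon (inhabits 0) (fun z => 0 < z < a /\ X z y = x).

Lemma X_region_X (x y : R) : 0 < x < a -> X_region (X x y) y.
Proof.
  intros Hx. split; [apply X_range; lra|apply X_lt; lra].
Qed.

Lemma X_region_range (x y : R) : X_region x y -> 0 < x < a.
Proof. intros [H1 H2]. specialize (X_range a y a_range). lra. Qed.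

(** At height [y] the trajectory from [x] is at or left of [x], because abscissas never exceed the
    starting one, and the trajectory from [a] is right of [x]; the intermediate value theorem gives
    a start in between. *)
Lemma foot_spec (x y : R) : X_region x y -> 0 < foot x y < a /\ X (foot x y) y = x.
Proof.
  intros Hxy. unfold foot. apply epsilon_spec.
  assert (Hx := X_region_range x y Hxy). destruct Hxy as [_ Hxa].
  assert (Rx := X_range x y ltac:(lra)).
  destruct (Req_dec (X x y) x) as [E|E]; [now exists x|].
  destruct (IVT_interv (fun z => X z y - x) x a) as [z [Hz Ez]]; try lra.
  - intros z Hz. apply continuity_pt_minus.
    + apply (continuity_2d_pt_section1 X), X_cont. lra.
    + apply continuity_pt_const. now intros u v.
  - exists z. split; [|lra]. destruct (Req_dec z a) as [->|]; lra.
Qed.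

Lemma foot_X (x y : R) : 0 < x < a -> foot (X x y) y = x.
Proof.
  intros Hx. destruct (foot_spec _ _ (X_region_X x y Hx)) as [H1 H2].
  destruct (Rtotal_order (foot (X x y) y) x) as [H|[H|H]]; [|exact H|];
    apply (X_lt _ _ y) in H; lra.
Qed.

Lemma foot_start (x : R) : 0 < x < a -> foot x y0 = x.
Proof.
  intros Hx. rewrite <- (X_start x) at 1 by lra. now apply foot_X.
Qed.

Lemma X_region_open (x y : R) : X_region x y -> locally_2d X_region x y.
Proof.
  intros [H1 H2].
  destruct (continuity_pt_eps _ _ (X_cont_y a y a_range) ((X a y - x) / 2))
    as [r [Hr Hr']]; [lra|].
  assert (Hm : 0 < Rmin r (Rmin x ((X a y - x) / 2)))
    by (repeat apply Rmin_pos; lra).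
  exists (mkposreal _ Hm). simpl. intros u v Hu Hv.
  assert (A1 := Rmin_l r (Rmin x ((X a y - x) / 2))).
  assert (A2 := Rmin_r r (Rmin x ((X a y - x) / 2))).
  assert (A3 := Rmin_l x ((X a y - x) / 2)).
  assert (A4 := Rmin_r x ((X a y - x) / 2)).
  specialize (Hr' v ltac:(lra)). apply Rabs_def2 in Hr'. apply Rabs_def2 in Hu.
  split; lra.
Qed.

(** The trajectories from [q - d] and [q + d] pass strictly on either side of [(x, y)], hence of all
    nearby points, whose feet are then trapped by monotonicity of [X]. *)
Lemma foot_cont (x y : R) : X_region x y -> continuity_2d_pt foot x y.
Proof.
  intros Hxy e. destruct (foot_spec x y Hxy) as [Hp Ep].
  set (q := foot x y) in *.
  set (d := Rmin e (Rmin (q / 2) ((a - q) / 2))).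
  assert (Hd : 0 < d) by (repeat apply Rmin_pos; try apply cond_pos; lra).
  assert (D1 : d <= e) by apply Rmin_l.
  assert (D2 : d <= Rmin (q / 2) ((a - q) / 2)) by apply Rmin_r.
  assert (D3 := Rmin_l (q / 2) ((a - q) / 2)).
  assert (D4 := Rmin_r (q / 2) ((a - q) / 2)).
  assert (L1 := X_lt (q - d) q y ltac:(lra) ltac:(lra) ltac:(lra)).
  assert (L2 := X_lt q (q + d) y ltac:(lra) ltac:(lra) ltac:(lra)).
  rewrite Ep in L1, L2.
  destruct (continuity_pt_eps _ _ (X_cont_y (q - d) y ltac:(lra))
    ((x - X (q - d) y) / 2)) as [r1 [Hr1 K1]]; [lra|].
  destruct (continuity_pt_eps _ _ (X_cont_y (q + d) y ltac:(lra))
    ((X (q + d) y - x) / 2)) as [r2 [Hr2 K2]]; [lra|].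
  destruct (X_region_open x y Hxy) as [r0 Hr0].
  assert (Hm : 0 < Rmin (Rmin r0 (Rmin r1 r2))
             (Rmin ((x - X (q - d) y) / 2) ((X (q + d) y - x) / 2))).
  { repeat apply Rmin_pos; try apply cond_pos; lra. }
  exists (mkposreal _ Hm). simpl. intros u v Hu Hv.
  assert (A1 := Rmin_l (Rmin r0 (Rmin r1 r2))
             (Rmin ((x - X (q - d) y) / 2) ((X (q + d) y - x) / 2))).
  assert (A2 := Rmin_r (Rmin r0 (Rmin r1 r2))
             (Rmin ((x - X (q - d) y) / 2) ((X (q + d) y - x) / 2))).
  set (rho := Rmin (Rmin r0 (Rmin r1 r2)) _) in *.
  assert (A3 := Rmin_l r0 (Rmin r1 r2)). assert (A4 := Rmin_r r0 (Rmin r1 r2)).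
  assert (A5 := Rmin_l r1 r2). assert (A6 := Rmin_r r1 r2).
  assert (A7 := Rmin_l ((x - X (q - d) y) / 2) ((X (q + d) y - x) / 2)).
  assert (A8 := Rmin_r ((x - X (q - d) y) / 2) ((X (q + d) y - x) / 2)).
  specialize (K1 v ltac:(lra)). specialize (K2 v ltac:(lra)).
  destruct (foot_spec u v (Hr0 u v ltac:(lra) ltac:(lra))) as [Hp' Ep'].
  apply Rabs_def2 in K1. apply Rabs_def2 in K2. apply Rabs_def2 in Hu.
  assert (F1 : q - d < foot u v).
  { apply Rnot_le_lt. intros [H|H].
    - apply (X_lt _ _ v) in H; lra.
    - rewrite H in Ep'. lra. }
  assert (F2 : foot u v < q + d).
  { apply Rnot_le_lt. intros [H|H].
    - apply (X_lt _ _ v) in H; lra.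
    - rewrite <- H in Ep'. lra. }
  apply Rabs_def1; lra.
Qed.

(* [w x y'] is compared with [w] at the point of height [y'] of the trajectory
   through [(x, y)]. *)
Lemma transport_derive_y (w wx h : R -> R -> R) :
  (forall x y, X_region x y -> is_derive (fun z => w z y) x (wx x y)) ->
  (forall x y, X_region x y -> continuity_2d_pt wx x y) ->
  (forall x s, 0 < x < a -> is_derive (fun s => w (X x s) s) s (h (X x s) s)) ->
  forall x y, X_region x y ->
    is_derive (fun z => w x z) y (h x y - g x y * wx x y).
Proof.
  intros Hwx Hc Hw x y Hxy. destruct (foot_spec x y Hxy) as [Hp Ep].
  set (q := foot x y) in *.
  apply is_derive_slope. intros e He.
  (* [d] is a common tolerance for the trajectory slope and for [wx] that keeps their product within
     [e / 2]. *)
  assert (Hprod : continuity_2d_pt (fun u v => u * v) (g x y) (wx x y)).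
  { apply continuity_2d_pt_mult;
      [apply continuity_2d_pt_id1|apply continuity_2d_pt_id2]. }
  assert (He2 : 0 < e / 2) by lra.
  destruct (Hprod (mkposreal _ He2)) as [d Hd]. simpl in Hd.
  destruct (X_region_open x y Hxy) as [r0 Hr0].
  destruct (Hc x y Hxy d) as [r1 Hr1].
  assert (HXq := X_ode q y ltac:(lra)).
  destruct (is_derive_slope_lim _ _ _ HXq d (cond_pos d)) as [r2 [Pr2 Hr2]].
  destruct (is_derive_slope_lim _ _ _ (Hw q y Hp) (e / 2) He2) as [r3 [Pr3 Hr3]].
  set (rho := Rmin r0 r1).
  assert (Prho : 0 < rho) by (apply Rmin_pos; apply cond_pos).
  destruct (continuity_pt_eps _ _ (X_cont_y q y ltac:(lra)) rho Prho)
    as [r4 [Pr4 Hr4]].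
  exists (Rmin rho (Rmin r2 (Rmin r3 r4))).
  split; [repeat apply Rmin_pos; try apply cond_pos; assumption|].
  intros y' Hy' Hne.
  assert (A1 := Rmin_l rho (Rmin r2 (Rmin r3 r4))).
  assert (A2 := Rmin_r rho (Rmin r2 (Rmin r3 r4))).
  assert (A3 := Rmin_l r2 (Rmin r3 r4)). assert (A4 := Rmin_r r2 (Rmin r3 r4)).
  assert (A5 := Rmin_l r3 r4). assert (A6 := Rmin_r r3 r4).
  assert (A7 : rho <= r0) by apply Rmin_l.
  assert (A8 : rho <= r1) by apply Rmin_r.
  specialize (Hr2 y' ltac:(lra) Hne). specialize (Hr3 y' ltac:(lra) Hne).
  specialize (Hr4 y' ltac:(lra)).
  rewrite Ep in Hr2, Hr3, Hr4.
  set (x1 := X q y') in *.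
  assert (Hseg : forall z, Rmin x1 x <= z <= Rmax x1 x -> Rabs (z - x) < rho).
  { intros z Hz. apply Rle_lt_trans with (Rabs (x1 - x)); [|exact Hr4].
    unfold Rmin, Rmax in Hz; destruct (Rle_dec x1 x); unfold Rabs;
      repeat destruct Rcase_abs; lra. }
  destruct (mvt_between (fun z => w z y') (fun z => wx z y') x1 x)
    as [xi [Hxi Exi]].
  { intros z Hz. apply Hwx, Hr0; [|lra]. apply Hseg in Hz. lra. }
  apply Hseg in Hxi.
  (* To go from [(x, y)] to [(x, y')], follow the trajectory to [(x1, y')], at rate [S1] close to
     [h x y], then return horizontally from [x1] to [x], which costs [S2 * wx xi y'] with [S2] close
     to [g x y]. *)
  set (S1 := (w x1 y' - w x y) / (y' - y)) in *.
  set (S2 := (x1 - x) / (y' - y)) in *.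
  exists (S1 - S2 * wx xi y'). split.
  - replace (w x y' - w x y)
      with (w x1 y' - w x y + (w x y' - w x1 y')) by ring.
    rewrite Exi. unfold S1, S2. field. lra.
  - assert (K1 := Hd S2 (wx xi y') Hr2 (Hr1 xi y' ltac:(lra) ltac:(lra))).
    replace (S1 - S2 * wx xi y' - (h x y - g x y * wx x y))
      with ((S1 - h x y) - (S2 * wx xi y' - g x y * wx x y)) by ring.
    apply Rabs_def2 in K1. apply Rabs_def2 in Hr3. apply Rabs_def1; lra.
Qed.

(** * Integration along the trajectories and its regularity *)

Definition integral_along (h : R -> R -> R) (x y : R) : R :=
  RInt (fun s => h (X (foot x y) s) s) y0 y.

Lemma along_cont_y (h : R -> R -> R) (x s : R) :
  (forall x y, X_region x y -> continuity_2d_pt h x y) -> 0 < x < a ->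
  continuity_pt (fun s => h (X x s) s) s.
Proof.
  intros Hh Hx. apply (continuity_2d_pt_section2 (fun x s => h (X x s) s)).
  apply (along_cont X_region h a); auto; [lra|]. intros; now apply X_region_X.
Qed.

Lemma integral_along_X (h : R -> R -> R) (x y : R) : 0 < x < a ->
  integral_along h (X x y) y = RInt (fun s => h (X x s) s) y0 y.
Proof. intros Hx. unfold integral_along. now rewrite foot_X. Qed.

Lemma integral_along_start (h : R -> R -> R) (x : R) : integral_along h x y0 = 0.
Proof. apply (RInt_point y0 (fun s => h (X (foot x y0) s) s)). Qed.

Lemma integral_along_derive_along (h : R -> R -> R) (x s : R) :
  (forall x y, X_region x y -> continuity_2d_pt h x y) -> 0 < x < a ->
  is_derive (fun s => integral_along h (X x s) s) s (h (X x s) s).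
Proof.
  intros Hh Hx.
  apply (is_derive_ext (fun s => RInt (fun s => h (X x s) s) y0 s)).
  { intros t. symmetry. now apply integral_along_X. }
  apply (is_derive_RInt_upper (fun s => h (X x s) s)).
  intros t. now apply along_cont_y.
Qed.

Lemma integral_along_cont (h : R -> R -> R) :
  (forall x y, X_region x y -> continuity_2d_pt h x y) ->
  forall x y, X_region x y -> continuity_2d_pt (integral_along h) x y.
Proof.
  intros Hh x y Hxy. destruct (foot_spec x y Hxy) as [Hp _].
  apply (continuity_2d_pt_comp2
    (fun x y => RInt (fun s => h (X x s) s) y0 y) foot (fun _ y => y)).
  - apply continuity_2d_RInt with (lo := 0) (hi := a); [|exact Hp].
    intros u s Hu. apply (along_cont X_region h a); auto; [lra|].
    intros; now apply X_region_X.
  - now apply foot_cont.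
  - apply continuity_2d_pt_id2.
Qed.

(** The reciprocal of [X_jac] at the foot, expressed through [integral_along] so that the induction
    on the smoothness class covers it as well. *)
Definition foot_dx (x y : R) : R := exp (- integral_along gx x y).

Lemma foot_dx_X (x y : R) : 0 < x < a -> foot_dx (X x y) y = / X_jac x y.
Proof.
  intros Hx. unfold foot_dx, X_jac. now rewrite integral_along_X, exp_Ropp.
Qed.

Lemma gx_cont_region (x y : R) : X_region x y -> continuity_2d_pt gx x y.
Proof.
  intros H. apply gx_cont. assert (H' := X_region_range x y H). lra.
Qed.

Lemma foot_dx_cont (x y : R) : X_region x y -> continuity_2d_pt foot_dx x y.
Proof.
  intros H. apply (continuity_1d_2d_pt_comp exp).
  - apply derivable_continuous_pt, derivable_pt_exp.
  - apply continuity_2d_pt_opp, integral_along_cont; [|exact H].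
    exact gx_cont_region.
Qed.

Lemma foot_derive_x (x y : R) : X_region x y ->
  is_derive (fun z => foot z y) x (foot_dx x y).
Proof.
  intros H. destruct (foot_spec x y H) as [Hp Ep].
  assert (E : foot_dx x y = / X_jac (foot x y) y).
  { rewrite <- foot_dx_X by exact Hp. now rewrite Ep. }
  rewrite E. apply (is_derive_inverse (fun z => X z y)).
  - apply X_derive. lra.
  - apply Rgt_not_eq, exp_pos.
  - now apply (continuity_2d_pt_section1 foot), foot_cont.
  - destruct (X_region_open x y H) as [r Hr]. exists r.
    split; [apply cond_pos|]. intros x' Hx'. apply foot_spec, Hr; [exact Hx'|].
    rewrite Rminus_diag, Rabs_R0. apply cond_pos.
Qed.

(** The foot is constant along trajectories, so [transport_derive_y] applies with derivative zero
    along them. *)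
Lemma foot_derive_y (x y : R) : X_region x y ->
  is_derive (fun z => foot x z) y (- (g x y * foot_dx x y)).
Proof.
  intros H.
  replace (- (g x y * foot_dx x y)) with (0 - g x y * foot_dx x y) by ring.
  apply (transport_derive_y foot foot_dx (fun _ _ => 0)); auto.
  - exact foot_derive_x.
  - exact foot_dx_cont.
  - intros u s Hu. apply (is_derive_ext (fun _ => u)).
    + intros t. symmetry. now apply foot_X.
    + apply is_derive_Rconst.
Qed.

(** Differentiation under the integral sign with respect to the starting point, then the chain rule
    through [foot]. On the trajectory [/ foot_dx] is [X_jac]; in this form the integrand is a
    function on the plane and the result is again an [integral_along]. *)
Lemma integral_along_derive_x (h hx : R -> R -> R) :
  (forall x y, X_region x y -> continuity_2d_pt h x y) ->
  (forall x y, X_region x y -> continuity_2d_pt hx x y) ->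
  (forall x y, X_region x y -> is_derive (fun z => h z y) x (hx x y)) ->
  forall x y, X_region x y ->
    is_derive (fun z => integral_along h z y) x
      (integral_along (fun x y => hx x y * / foot_dx x y) x y * foot_dx x y).
Proof.
  intros Hh Hhx Hd x y Hxy. destruct (foot_spec x y Hxy) as [Hp Ep].
  set (k := fun u s => h (X u s) s).
  set (dk := fun u s => hx (X u s) s * X_jac u s).
  assert (Hk : forall u s, 0 < u < a -> is_derive (fun z => k z s) u (dk u s)).
  { intros u s Hu. apply (is_derive_Rcomp (fun z => h z s) (fun u => X u s)).
    - now apply Hd, X_region_X.
    - apply X_derive. lra. }
  assert (Hloc : locally (foot x y) (fun u => 0 < u < a)).
  { apply (open_and (fun u => 0 < u) (fun u => u < a));
      [apply open_gt|apply open_lt|exact Hp]. }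
  assert (E : integral_along (fun x y => hx x y * / foot_dx x y) x y
              = RInt (fun s => Derive (fun u => k u s) (foot x y)) y0 y).
  { unfold integral_along. apply RInt_ext. intros s _.
    transitivity (dk (foot x y) s).
    - unfold dk. rewrite foot_dx_X by exact Hp. now rewrite Rinv_inv.
    - symmetry. now apply is_derive_unique, Hk. }
  rewrite E.
  apply (is_derive_Rcomp (fun u => RInt (k u) y0 y) (fun z => foot z y));
    [|now apply foot_derive_x].
  apply (is_derive_RInt_param k y0 y (foot x y)).
  - revert Hloc. apply filter_imp. intros u Hu s _. eexists. now apply Hk.
  - intros s _. apply continuity_2d_pt_ext_loc with dk.
    + destruct Hloc as [r Hr]. exists r. intros u v Hu _.
      symmetry. apply is_derive_unique, Hk, (Hr u Hu).
    + apply continuity_2d_pt_mult.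
      * apply (along_cont X_region hx a); auto; [lra|].
        intros; now apply X_region_X.
      * apply X_jac_cont. lra.
  - revert Hloc. apply filter_imp. intros u Hu. apply ex_RInt_cont.
    intros s. now apply along_cont_y.
Qed.

Lemma integral_along_smooth (k : nat) (h : R -> R -> R) :
  smooth_on k X_region g -> smooth_on k X_region gx ->
  smooth_on k X_region h -> smooth_on k X_region (integral_along h).
Proof.
  revert h. induction k as [|k IH]; intros h Hg Hgx Hh.
  - split; [|trivial]. apply integral_along_cont. exact (smooth_on_cont _ _ _ Hh).
  - apply smooth_on_pred in Hg. apply smooth_on_pred in Hgx.
    assert (Hh' := smooth_on_pred _ _ _ Hh).
    assert (Hc := smooth_on_cont _ _ _ Hh).
    destruct Hh as [_ [hx [hy [Hd [Hx _]]]]].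
    set (Ix := fun x y =>
      integral_along (fun x y => hx x y * / foot_dx x y) x y * foot_dx x y).
    (* The induction hypothesis is used twice at order [k]: here for [gx], and below for
       [hx x y * / foot_dx x y]. *)
    assert (Hfoot : smooth_on k X_region foot_dx).
    { apply smooth_on_exp, smooth_on_opp; [exact X_region_open|].
      now apply IH. }
    assert (HIx : smooth_on k X_region Ix).
    { apply smooth_on_mult; [|exact Hfoot]. apply IH; try assumption.
      apply smooth_on_mult; [exact Hx|]. apply smooth_on_inv; [|exact Hfoot].
      intros x y _. apply Rgt_not_eq, exp_pos. }
    assert (HdIx : forall x y, X_region x y ->
              is_derive (fun z => integral_along h z y) x (Ix x y)).
    { apply integral_along_derive_x; [exact Hc|exact (smooth_on_cont _ _ _ Hx)|].
      intros x y Hxy. now apply Hd. }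
    split; [now apply integral_along_cont|].
    exists Ix, (fun x y => h x y - g x y * Ix x y). split; [|split].
    + intros x y Hxy. split; [now apply HdIx|].
      apply transport_derive_y; [exact HdIx| | |exact Hxy].
      * exact (smooth_on_cont _ _ _ HIx).
      * intros u s Hu. now apply integral_along_derive_along.
    + exact HIx.
    + apply (smooth_on_plus k X_region h (fun x y => - (g x y * Ix x y)));
        [exact Hh'|].
      apply smooth_on_opp; [exact X_region_open|now apply smooth_on_mult].
Qed.

(** One order is gained because both partial derivatives of [foot] are products of [g] and
    [foot_dx], up to sign. *)
Lemma foot_smooth (k : nat) :
  smooth_on k X_region g -> smooth_on k X_region gx ->
  smooth_on (S k) X_region foot.
Proof.
  intros Hg Hgx.
  assert (Hdx : smooth_on k X_region foot_dx).
  { apply smooth_on_exp, smooth_on_opp; [exact X_region_open|].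
    now apply integral_along_smooth. }
  split; [exact foot_cont|].
  exists foot_dx, (fun x y => - (g x y * foot_dx x y)). split; [|split].
  - intros x y Hxy. split; [now apply foot_derive_x|now apply foot_derive_y].
  - exact Hdx.
  - apply smooth_on_opp; [exact X_region_open|now apply smooth_on_mult].
Qed.

(** * The second-order equation along the flow *)

Variable b : vfield.
Hypothesis b_smooth1 : smooth_on 3 X_region (comp1 b).
Hypothesis b_smooth2 : smooth_on 3 X_region (comp2 b).
Hypothesis b_pos : forall x y, X_region x y -> 0 < comp2 b x y.
Hypothesis g_slope : forall x y, X_region x y ->
  g x y = comp1 b x y / comp2 b x y.
Hypothesis g_smooth : smooth_on 2 X_region g.
Hypothesis gx_smooth : smooth_on 2 X_region gx.

Definition along_b (w : R -> R -> R) (x y : R) : R :=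
  comp1 b x y * d_x w x y + comp2 b x y * d_y w x y.

Lemma along_b_smooth (k : nat) (w : R -> R -> R) : (k <= 3)%nat ->
  smooth_on (S k) X_region w -> smooth_on k X_region (along_b w).
Proof.
  intros Hk Hw.
  apply smooth_on_plus; apply smooth_on_mult.
  - now apply smooth_on_le with 3%nat.
  - now apply smooth_on_d_x; [exact X_region_open|].
  - now apply smooth_on_le with 3%nat.
  - now apply smooth_on_d_y; [exact X_region_open|].
Qed.

(** The height grows at speed [comp2 b] in time, so a derivative in height is the derivative along
    [b] divided by that speed. *)
Lemma along_b_derive (w : R -> R -> R) (x s : R) :
  0 < x < a -> smooth_on 1 X_region w ->
  is_derive (fun s => w (X x s) s) s
    (along_b w (X x s) s * / comp2 b (X x s) s).
Proof.
  intros Hx Hw. assert (HU := X_region_X x s Hx).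
  replace (along_b w (X x s) s * / comp2 b (X x s) s)
    with (d_x w (X x s) s * g (X x s) s + d_y w (X x s) s * 1).
  - apply (smooth_on_derive_curve X_region w (X x) (fun s => s));
      [exact X_region_open|exact Hw|exact HU|apply X_ode; lra|].
    apply (is_derive_id s).
  - rewrite g_slope by exact HU. unfold along_b. field.
    apply Rgt_not_eq, b_pos, HU.
Qed.

(** Every point of the region lies on a trajectory, so [along_b] can be read off from derivatives
    along trajectories. *)
Lemma along_b_eq (w h : R -> R -> R) :
  smooth_on 1 X_region w ->
  (forall x s, 0 < x < a -> is_derive (fun s => w (X x s) s) s (h (X x s) s)) ->
  forall x y, X_region x y -> along_b w x y = h x y * comp2 b x y.
Proof.
  intros Hw Hh x y Hxy. destruct (foot_spec x y Hxy) as [Hp Ep].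
  assert (E : along_b w x y * / comp2 b x y = h x y).
  { rewrite <- Ep.
    rewrite <- (is_derive_unique _ _ _ (along_b_derive w _ y Hp Hw)).
    apply (is_derive_unique _ _ _ (Hh _ y Hp)). }
  rewrite <- E. field. apply Rgt_not_eq, b_pos, Hxy.
Qed.

Lemma along_b_ext (w1 w2 : R -> R -> R) :
  (forall x y, X_region x y -> w1 x y = w2 x y) ->
  forall x y, X_region x y -> along_b w1 x y = along_b w2 x y.
Proof.
  intros E x y Hxy. destruct (X_region_open x y Hxy) as [r Hr].
  unfold along_b, d_x, d_y. f_equal; f_equal; apply Derive_ext_loc; exists r;
    intros z Hz; apply E, Hr; try exact Hz;
    rewrite Rminus_diag, Rabs_R0; apply cond_pos.
Qed.

(** The field [(b ⊗ b) grad w] is [along_b w] times [b], and the divergence of such a product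
    follows from Leibniz. *)
Lemma Delta_par_along_b (w : R -> R -> R) :
  smooth_on 2 X_region w -> forall x y, X_region x y ->
  Delta_par b w x y =
    along_b (along_b w) x y + divergence b x y * along_b w x y.
Proof.
  intros Hw x y Hxy.
  assert (HW := along_b_smooth 1 w ltac:(lia) Hw).
  destruct (smooth_on_d_x 0 _ _ X_region_open HW) as [_ Wx].
  destruct (smooth_on_d_y 0 _ _ X_region_open HW) as [_ Wy].
  destruct (smooth_on_d_x 2 _ _ X_region_open b_smooth1) as [_ Bx].
  destruct (smooth_on_d_y 2 _ _ X_region_open b_smooth2) as [_ By_].
  assert (E1 : d_x (comp1 (fun x y => mulmv (tensor (b x y) (b x y)) (grad w x y)))
                 x y = d_x (comp1 b) x y * along_b w x y
                       + comp1 b x y * d_x (along_b w) x y).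
  { apply is_derive_unique.
    apply (is_derive_ext (fun z => comp1 b z y * along_b w z y)).
    - intros z. unfold along_b, comp1, comp2, mulmv, tensor, dot, grad. simpl. ring.
    - apply (is_derive_Rmult (fun z => comp1 b z y) (fun z => along_b w z y)).
      + now apply Bx.
      + now apply Wx. }
  assert (E2 : d_y (comp2 (fun x y => mulmv (tensor (b x y) (b x y)) (grad w x y)))
                 x y = d_y (comp2 b) x y * along_b w x y
                       + comp2 b x y * d_y (along_b w) x y).
  { apply is_derive_unique.
    apply (is_derive_ext (fun z => comp2 b x z * along_b w x z)).
    - intros z. unfold along_b, comp1, comp2, mulmv, tensor, dot, grad. simpl. ring.
    - apply (is_derive_Rmult (fun z => comp2 b x z) (fun z => along_b w x z)).
      + now apply By_.
      + now apply Wy. }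
  unfold Delta_par, divergence at 1. rewrite E1, E2.
  change (along_b (along_b w) x y)
    with (comp1 b x y * d_x (along_b w) x y + comp2 b x y * d_y (along_b w) x y).
  unfold divergence. ring.
Qed.

(** * Explicit solution of the Cauchy problem and its uniqueness *)

Variables (f : R -> R -> R) (P Q : R -> R).
Hypothesis f_smooth : smooth_on 2 X_region f.
Hypothesis P_smooth : Ck_line 2 (fun x => 0 < x < a) P.
Hypothesis Q_smooth : Ck_line 2 (fun x => 0 < x < a) Q.

(* [log_density], [flux] and [solution] are, in the coordinates of the plane, the
   H, <grad u, b> and u of the statement; the factors [/ comp2 b x y] come from
   integrating with respect to the height instead of the time. *)
Definition log_density : R -> R -> R :=
  integral_along (fun x y => divergence b x y * / comp2 b x y).

Definition flux : R -> R -> R := fun x y =>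
  exp (- log_density x y) *
  (Q (foot x y) +
   integral_along (fun x y => - f x y * exp (log_density x y) * / comp2 b x y) x y).

Definition solution : R -> R -> R := fun x y =>
  P (foot x y) + integral_along (fun x y => flux x y * / comp2 b x y) x y.

Lemma inv_b_smooth : smooth_on 2 X_region (fun x y => / comp2 b x y).
Proof.
  apply smooth_on_inv; [|now apply smooth_on_le with 3%nat; [lia|]].
  intros x y Hxy. now apply Rgt_not_eq, b_pos.
Qed.

Lemma divergence_smooth : smooth_on 2 X_region (divergence b).
Proof.
  apply (smooth_on_plus 2 X_region (d_x (comp1 b)) (d_y (comp2 b))).
  - now apply smooth_on_d_x; [exact X_region_open|].
  - now apply smooth_on_d_y; [exact X_region_open|].
Qed.

Lemma log_density_smooth : smooth_on 2 X_region log_density.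
Proof.
  apply integral_along_smooth; try assumption.
  apply smooth_on_mult; [exact divergence_smooth|exact inv_b_smooth].
Qed.

Lemma foot_comp_smooth (k : nat) (V : R -> R) : (k <= 3)%nat ->
  Ck_line k (fun x => 0 < x < a) V ->
  smooth_on k X_region (fun x y => V (foot x y)).
Proof.
  intros Hk HV. apply smooth_on_comp with (V := fun x => 0 < x < a).
  - exact HV.
  - apply smooth_on_le with 3%nat; [exact Hk|]. now apply foot_smooth.
  - intros x y Hxy. now apply foot_spec.
Qed.

Lemma source_smooth : smooth_on 2 X_region
  (fun x y => - f x y * exp (log_density x y) * / comp2 b x y).
Proof.
  apply (smooth_on_mult 2 X_region
           (fun x y => - f x y * exp (log_density x y)));
    [|exact inv_b_smooth].
  apply (smooth_on_mult 2 X_region (fun x y => - f x y)).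
  - now apply smooth_on_opp; [exact X_region_open|].
  - apply smooth_on_exp, log_density_smooth.
Qed.

Lemma flux_smooth : smooth_on 2 X_region flux.
Proof.
  apply (smooth_on_mult 2 X_region (fun x y => exp (- log_density x y))).
  - apply smooth_on_exp, smooth_on_opp;
      [exact X_region_open|exact log_density_smooth].
  - apply (smooth_on_plus 2 X_region (fun x y => Q (foot x y))).
    + now apply foot_comp_smooth; [lia|].
    + apply integral_along_smooth; try assumption. exact source_smooth.
Qed.

Lemma flux_over_b_smooth :
  smooth_on 2 X_region (fun x y => flux x y * / comp2 b x y).
Proof. apply smooth_on_mult; [exact flux_smooth|exact inv_b_smooth]. Qed.

Lemma solution_smooth : smooth_on 2 X_region solution.
Proof.
  apply (smooth_on_plus 2 X_region (fun x y => P (foot x y))).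
  - now apply foot_comp_smooth; [lia|].
  - apply integral_along_smooth; try assumption. exact flux_over_b_smooth.
Qed.

Lemma log_density_derive (x s : R) : 0 < x < a ->
  is_derive (fun s => log_density (X x s) s) s
    (divergence b (X x s) s * / comp2 b (X x s) s).
Proof.
  intros Hx.
  apply (integral_along_derive_along
           (fun x y => divergence b x y * / comp2 b x y)); [|exact Hx].
  apply (smooth_on_cont 2). apply smooth_on_mult;
    [exact divergence_smooth|exact inv_b_smooth].
Qed.

Lemma source_integral_derive (x s : R) : 0 < x < a ->
  is_derive (fun s => integral_along
      (fun x y => - f x y * exp (log_density x y) * / comp2 b x y) (X x s) s) s
    (- f (X x s) s * exp (log_density (X x s) s) * / comp2 b (X x s) s).
Proof.
  intros Hx.
  apply (integral_along_derive_along
    (fun x y => - f x y * exp (log_density x y) * / comp2 b x y)); [|exact Hx].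
  apply (smooth_on_cont 2), source_smooth.
Qed.

Lemma flux_integral_derive (x s : R) : 0 < x < a ->
  is_derive (fun s => integral_along
      (fun x y => flux x y * / comp2 b x y) (X x s) s) s
    (flux (X x s) s * / comp2 b (X x s) s).
Proof.
  intros Hx.
  apply (integral_along_derive_along
    (fun x y => flux x y * / comp2 b x y)); [|exact Hx].
  apply (smooth_on_cont 2), flux_over_b_smooth.
Qed.

Lemma along_b_solution (x y : R) : X_region x y -> along_b solution x y = flux x y.
Proof.
  intros Hxy.
  rewrite (along_b_eq solution (fun x y => flux x y * / comp2 b x y)).
  - field. now apply Rgt_not_eq, b_pos.
  - apply smooth_on_pred, solution_smooth.
  - intros u s Hu.
    apply (is_derive_ext (fun s => P u + integral_along
             (fun x y => flux x y * / comp2 b x y) (X u s) s)).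
    { intros t. unfold solution. now rewrite foot_X. }
    rewrite <- (Rplus_0_l (flux (X u s) s * _)).
    apply (is_derive_Rplus (fun _ => P u)); [apply is_derive_Rconst|].
    now apply flux_integral_derive.
  - exact Hxy.
Qed.

(** [flux] is the variation-of-constants formula for the first-order equation, with integrating
    factor [exp (log_density x y)]. *)
Lemma along_b_flux (x y : R) : X_region x y ->
  along_b flux x y = - divergence b x y * flux x y - f x y.
Proof.
  intros Hxy.
  rewrite (along_b_eq flux
    (fun x y => (- divergence b x y * flux x y - f x y) * / comp2 b x y)).
  - field. now apply Rgt_not_eq, b_pos.
  - apply smooth_on_pred, flux_smooth.
  - intros u s Hu.
    apply (is_derive_ext (fun s => exp (- log_density (X u s) s) *
      (Q u + integral_along (fun x y => - f x y * exp (log_density x y)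
         * / comp2 b x y) (X u s) s))).
    { intros t. unfold flux. now rewrite foot_X. }
    assert (E : flux (X u s) s = exp (- log_density (X u s) s) *
      (Q u + integral_along (fun x y => - f x y * exp (log_density x y)
         * / comp2 b x y) (X u s) s)) by (unfold flux; now rewrite foot_X).
    rewrite E. clear E. evar_last.
    + apply is_derive_Rmult.
      * apply is_derive_exp_comp. apply (is_derive_Ropp (fun s => log_density (X u s) s)).
        now apply log_density_derive.
      * apply is_derive_Rplus; [apply is_derive_Rconst|].
        now apply source_integral_derive.
    + cbv beta. rewrite exp_Ropp.
      assert (0 < exp (log_density (X u s) s)) by apply exp_pos.
      assert (0 < comp2 b (X u s) s) by now apply b_pos, X_region_X.
      field. lra.
  - exact Hxy.
Qed.

Lemma solution_equation (x y : R) : X_region x y ->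
  - Delta_par b solution x y = f x y.
Proof.
  intros Hxy.
  rewrite Delta_par_along_b; [|exact solution_smooth|exact Hxy].
  rewrite (along_b_ext (along_b solution) flux along_b_solution x y Hxy).
  rewrite along_b_solution, along_b_flux by exact Hxy. ring.
Qed.

Lemma log_density_start (x : R) : log_density x y0 = 0.
Proof. apply integral_along_start. Qed.

Lemma flux_start (x : R) : 0 < x < a -> flux x y0 = Q x.
Proof.
  intros Hx. unfold flux.
  rewrite integral_along_start, log_density_start, Ropp_0, exp_0.
  rewrite foot_start by exact Hx. ring.
Qed.

Lemma solution_start (x : R) : 0 < x < a -> solution x y0 = P x.
Proof.
  intros Hx. unfold solution.
  rewrite integral_along_start, foot_start by exact Hx. ring.
Qed.

(** The two first-order equations are integrated one after the other on a fixed trajectory: the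
    first identifies [along_b v] with [flux], the second then [v] with [solution]. *)
Lemma solution_unique (v : R -> R -> R) :
  smooth_on 2 X_region v ->
  (forall x y, X_region x y -> - Delta_par b v x y = f x y) ->
  (forall x, 0 < x < a -> v x y0 = P x) ->
  (forall x, 0 < x < a -> along_b v x y0 = Q x) ->
  forall x y, X_region x y -> v x y = solution x y.
Proof.
  intros Hv Hf HP HQ.
  assert (HW := along_b_smooth 1 v ltac:(lia) Hv).
  assert (Hflux : forall x s, 0 < x < a ->
            along_b v (X x s) s = flux (X x s) s).
  { intros x s Hx.
    set (K := fun s => integral_along (fun x y =>
      - f x y * exp (log_density x y) * / comp2 b x y) (X x s) s).
    assert (HK : forall t, is_derive K t
      (- f (X x t) t * exp (log_density (X x t) t) * / comp2 b (X x t) t)).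
    { intros t. exact (source_integral_derive x t Hx). }
    (* The integrating factor turns the equation into the vanishing of a derivative; at [y0] the
       constant is [Q x]. *)
    assert (E : along_b v (X x s) s * exp (log_density (X x s) s) - K s =
                along_b v (X x y0) y0 * exp (log_density (X x y0) y0) - K y0).
    { apply (derive_zero_const (fun s =>
        along_b v (X x s) s * exp (log_density (X x s) s) - K s)).
      intros t. evar_last.
      - apply (is_derive_Rminus
          (fun s => along_b v (X x s) s * exp (log_density (X x s) s)) K);
          [|apply HK].
        apply (is_derive_Rmult (fun s => along_b v (X x s) s)
                 (fun s => exp (log_density (X x s) s))).
        + exact (along_b_derive (along_b v) x t Hx HW).
        + apply (is_derive_exp_comp (fun s => log_density (X x s) s)).
          exact (log_density_derive x t Hx).
      - assert (HU := X_region_X x t Hx).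
        assert (Hb := b_pos _ _ HU).
        specialize (Hf _ _ HU).
        rewrite Delta_par_along_b in Hf by assumption.
        rewrite <- Hf. field. lra. }
    assert (EK : K y0 = 0) by (unfold K; apply integral_along_start).
    rewrite X_start, EK, log_density_start, exp_0, HQ in E by lra.
    unfold flux. rewrite foot_X by exact Hx. fold (K s).
    replace (Q x) with (along_b v (X x s) s * exp (log_density (X x s) s) - K s)
      by lra.
    rewrite exp_Ropp. assert (H := exp_pos (log_density (X x s) s)).
    field. lra. }
  intros x y Hxy. destruct (foot_spec x y Hxy) as [Hp Ep].
  set (q := foot x y) in *.
  set (K := fun s => integral_along (fun x y => flux x y * / comp2 b x y) (X q s) s).
  assert (HK : forall t, is_derive K t (flux (X q t) t * / comp2 b (X q t) t)).
  { intros t. exact (flux_integral_derive q t Hp). }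
  assert (E : v (X q y) y - K y = v (X q y0) y0 - K y0).
  { apply (derive_zero_const (fun s => v (X q s) s - K s)).
    intros t. evar_last.
    - apply (is_derive_Rminus (fun s => v (X q s) s) K); [|apply HK].
      exact (along_b_derive v q t Hp (smooth_on_pred _ _ _ Hv)).
    - rewrite Hflux by exact Hp. ring. }
  assert (EK : K y0 = 0) by (unfold K; apply integral_along_start).
  rewrite (X_start q), EK, HP in E by lra.
  unfold solution. fold q. unfold K in E. rewrite Ep in E. lra.
Qed.

(** * Return from height to time *)

(** The substitution from time to height, proved by comparing derivatives in [t]: both sides vanish
    at [t = 0]. *)
Lemma time_integral (x : R) (xx yy : R -> R) (h : R -> R -> R) :
  0 < x < a -> yy 0 = y0 -> (forall t, xx t = X x (yy t)) ->
  (forall t, is_derive yy t (comp2 b (xx t) (yy t))) ->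
  smooth_on 0 X_region h -> forall t,
  RInt (fun s => h (xx s) (yy s)) 0 t =
    integral_along (fun x y => h x y * / comp2 b x y) (xx t) (yy t).
Proof.
  intros Hx Hy0 Hxx Hyy Hh t.
  set (k := fun x y => h x y * / comp2 b x y).
  assert (Hk : forall x y, X_region x y -> continuity_2d_pt k x y).
  { apply (smooth_on_cont 0). apply smooth_on_mult; [exact Hh|].
    apply smooth_on_le with 2%nat; [lia|exact inv_b_smooth]. }
  assert (Hc : forall s, continuity_pt (fun s => h (xx s) (yy s)) s).
  { intros s.
    assert (H : continuity_pt (fun s => h (X x (yy s)) (yy s)) s).
    { apply (continuity_pt_comp yy (fun s => h (X x s) s)).
      - eapply is_derive_continuity_pt. apply Hyy.
      - apply along_cont_y; [|exact Hx]. apply (smooth_on_cont 0), Hh. }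
    apply (continuity_pt_ext (fun s => h (X x (yy s)) (yy s))); [|exact H].
    intros r. now rewrite <- Hxx. }
  assert (E : RInt (fun s => h (xx s) (yy s)) 0 t
              - integral_along k (X x (yy t)) (yy t)
            = RInt (fun s => h (xx s) (yy s)) 0 0
              - integral_along k (X x (yy 0)) (yy 0)).
  { apply (derive_zero_const (fun t => RInt (fun s => h (xx s) (yy s)) 0 t
              - integral_along k (X x (yy t)) (yy t))).
    intros s. evar_last.
    - apply (is_derive_Rminus (fun t => RInt (fun s => h (xx s) (yy s)) 0 t)
               (fun t => integral_along k (X x (yy t)) (yy t))).
      + apply (is_derive_RInt_upper (fun s => h (xx s) (yy s))), Hc.
      + apply (is_derive_Rcomp (fun s => integral_along k (X x s) s) yy).
        * apply integral_along_derive_along; [exact Hk|exact Hx].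
        * apply Hyy.
    - rewrite <- Hxx. unfold k. field.
      apply Rgt_not_eq, b_pos. rewrite Hxx. now apply X_region_X. }
  assert (E0 := RInt_point 0 (fun s => h (xx s) (yy s))).
  rewrite Hy0, integral_along_start, <- Hxx in E.
  unfold zero in E0; simpl in E0. lra.
Qed.

Lemma solution_formula (x : R) (xx yy : R -> R) :
  0 < x < a -> yy 0 = y0 -> (forall t, xx t = X x (yy t)) ->
  (forall t, is_derive yy t (comp2 b (xx t) (yy t))) ->
  let H := fun s => RInt (fun t => divergence b (xx t) (yy t)) 0 s in
  forall t, solution (xx t) (yy t) =
    P x + Q x * RInt (fun s => exp (- H s)) 0 t
    + RInt (fun v => exp (- H v) *
              RInt (fun s => - f (xx s) (yy s) * exp (H s)) 0 v) 0 t.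
Proof.
  intros Hx Hy0 Hxx Hyy H t.
  assert (HU : forall s, X_region (xx s) (yy s))
    by (intros s; rewrite Hxx; now apply X_region_X).
  assert (Hfoot : forall s, foot (xx s) (yy s) = x)
    by (intros s; rewrite Hxx; now apply foot_X).
  assert (HI := fun h => time_integral x xx yy h Hx Hy0 Hxx Hyy).
  assert (Hc0 : forall h, smooth_on 2 X_region h -> smooth_on 0 X_region h)
    by (intros h; apply smooth_on_le; lia).
  assert (HH : forall s, H s = log_density (xx s) (yy s)).
  { intros s. apply (HI (divergence b)). now apply Hc0, divergence_smooth. }
  set (src := fun x y => - f x y * exp (log_density x y)).
  assert (Hsrc : smooth_on 2 X_region src).
  { apply (smooth_on_mult 2 X_region (fun x y => - f x y)).
    - now apply smooth_on_opp; [exact X_region_open|].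
    - apply smooth_on_exp, log_density_smooth. }
  assert (HS : forall v, RInt (fun s => - f (xx s) (yy s) * exp (H s)) 0 v
            = integral_along (fun x y => src x y * / comp2 b x y) (xx v) (yy v)).
  { intros v. rewrite <- (HI src) by now apply Hc0.
    apply RInt_ext. intros s _. unfold src. now rewrite HH. }
  (* On the trajectory from [x], [flux] is [Q x * E1 + E2]. Both parts are smooth functions on the
     region, hence integrable along the trajectory, and the integral may be split. *)
  set (E1 := fun x y => exp (- log_density x y)).
  set (E2 := fun x y => exp (- log_density x y) *
               integral_along (fun x y => src x y * / comp2 b x y) x y).
  assert (HE1 : smooth_on 2 X_region E1).
  { apply smooth_on_exp, smooth_on_opp;
      [exact X_region_open|exact log_density_smooth]. }
  assert (HE2 : smooth_on 2 X_region E2).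
  { apply smooth_on_mult; [exact HE1|].
    apply integral_along_smooth; try assumption.
    apply smooth_on_mult; [exact Hsrc|exact inv_b_smooth]. }
  rewrite (RInt_ext (fun s => exp (- H s)) (fun s => E1 (xx s) (yy s)))
    by (intros s _; now rewrite HH).
  rewrite (RInt_ext (fun v => exp (- H v) * _) (fun s => E2 (xx s) (yy s)))
    by (intros s _; rewrite HH, HS; reflexivity).
  assert (Hcurve : forall h, smooth_on 2 X_region h ->
            ex_RInt (fun s => h (xx s) (yy s)) 0 t).
  { intros h Hh. apply ex_RInt_cont. intros s.
    apply (continuity_pt_curve h xx yy).
    - exact (smooth_on_cont 2 X_region h Hh _ _ (HU s)).
    - apply (continuity_pt_ext (fun s => X x (yy s))).
      + intros r. now rewrite Hxx.
      + apply (continuity_pt_comp yy (X x)).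
        * eapply is_derive_continuity_pt. apply Hyy.
        * apply X_cont_y. lra.
    - eapply is_derive_continuity_pt. apply Hyy. }
  unfold solution. rewrite <- (HI flux) by now apply Hc0, flux_smooth.
  rewrite Hfoot.
  rewrite (RInt_ext (fun s => flux (xx s) (yy s))
            (fun s => plus (scal (Q x) (E1 (xx s) (yy s))) (E2 (xx s) (yy s)))).
  - rewrite (RInt_plus (fun s => scal (Q x) (E1 (xx s) (yy s)))
               (fun s => E2 (xx s) (yy s))).
    + rewrite (RInt_scal (fun s => E1 (xx s) (yy s))) by now apply Hcurve.
      unfold plus, scal; simpl; unfold mult; simpl. ring.
    + apply (ex_RInt_scal (fun s => E1 (xx s) (yy s))). now apply Hcurve.
    + now apply Hcurve.
  - intros s _. unfold plus, scal; simpl; unfold mult; simpl.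
    unfold flux, E1, E2. rewrite Hfoot. fold src. unfold src. ring.
Qed.

End ScalarFlow.

(** * The normalized field on the left half of the strip *)

Lemma sign_change_zero (c : R -> R) (y0 : R) :
  continuity_pt c y0 ->
  (forall y, y < y0 -> 0 < c y) -> (forall y, y0 < y -> c y < 0) -> c y0 = 0.
Proof.
  intros Hc Hl Hr. apply NNPP. intros Hn.
  destruct (continuity_pt_eps c y0 Hc (Rabs (c y0))) as [r [Pr H]].
  { now apply Rabs_pos_lt. }
  assert (H1 := H (y0 - r / 2) ltac:(apply Rabs_def1; lra)).
  assert (H2 := H (y0 + r / 2) ltac:(apply Rabs_def1; lra)).
  assert (K1 := Hl (y0 - r / 2) ltac:(lra)).
  assert (K2 := Hr (y0 + r / 2) ltac:(lra)).
  apply Rabs_def2 in H1. apply Rabs_def2 in H2.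
  unfold Rabs in *. destruct (Rcase_abs (c y0)); lra.
Qed.

Lemma enorm_pos (v : vec) : 0 < snd v -> 0 < enorm v.
Proof.
  intros H. apply sqrt_lt_R0.
  assert (0 <= fst v ^ 2) by apply pow2_ge_0. nra.
Qed.

Section Normalized.

Variables (B : vfield) (U : R -> R -> Prop).
Hypothesis U_open : forall x y, U x y -> locally_2d U x y.
Hypothesis B_pos : forall x y, U x y -> 0 < comp2 B x y.

Lemma normalized_comp2_pos (x y : R) : U x y -> 0 < comp2 (normalized B) x y.
Proof.
  intros H. apply Rdiv_lt_0_compat; [now apply B_pos|].
  now apply enorm_pos, B_pos.
Qed.

Lemma inv_enorm_smooth (k : nat) :
  smooth_on k U (comp1 B) -> smooth_on k U (comp2 B) ->
  smooth_on k U (fun x y => / enorm (B x y)).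
Proof.
  intros H1 H2. apply smooth_on_inv.
  { intros x y Hxy. now apply Rgt_not_eq, enorm_pos, B_pos. }
  apply (smooth_on_sqrt k U
    (fun x y => comp1 B x y ^ 2 + comp2 B x y ^ 2)).
  - intros x y Hxy. specialize (B_pos x y Hxy).
    assert (0 <= comp1 B x y ^ 2) by apply pow2_ge_0. nra.
  - apply (smooth_on_ext k U
      (fun x y => comp1 B x y * comp1 B x y + comp2 B x y * comp2 B x y));
      [exact U_open|intros; ring|].
    apply smooth_on_plus; now apply smooth_on_mult.
Qed.

Lemma normalized_smooth (k : nat) :
  smooth_on k U (comp1 B) -> smooth_on k U (comp2 B) ->
  smooth_on k U (comp1 (normalized B)) /\ smooth_on k U (comp2 (normalized B)).
Proof.
  intros H1 H2. assert (H := inv_enorm_smooth k H1 H2). split.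
  - now apply (smooth_on_mult k U (comp1 B) (fun x y => / enorm (B x y))).
  - now apply (smooth_on_mult k U (comp2 B) (fun x y => / enorm (B x y))).
Qed.

End Normalized.

(** An open set on which [comp2 B] is positive, hence the normalized field is C^3. It contains the
    wall [x = 0], so compact rectangles may touch the wall. *)
Definition left_strip (eps d x y : R) : Prop := - eps < x < d / 2.

Lemma left_strip_open (eps d x y : R) :
  left_strip eps d x y -> locally_2d (left_strip eps d) x y.
Proof.
  intros [H1 H2].
  assert (Hr : 0 < Rmin (x + eps) (d / 2 - x)) by (apply Rmin_pos; lra).
  exists (mkposreal _ Hr). simpl. intros u v Hu _.
  assert (A1 := Rmin_l (x + eps) (d / 2 - x)).
  assert (A2 := Rmin_r (x + eps) (d / 2 - x)).
  apply Rabs_def2 in Hu. unfold left_strip. lra.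
Qed.

Section StandingConditions.

Variables (B : vfield) (eps d L : R).
Hypothesis B_C3 : Ck_plane 3 (fun _ _ => True) (comp1 B) /\
                  Ck_plane 3 (fun _ _ => True) (comp2 B).
Hypothesis B_cond : standing_conditions B eps d L.

Lemma left_strip_pos (x y : R) : left_strip eps d x y -> 0 < comp2 B x y.
Proof. intros H. now apply (sc_By_left _ _ _ _ B_cond). Qed.

Lemma left_strip_range (x y : R) : 0 <= x < d / 2 -> left_strip eps d x y.
Proof. intros H. assert (H' := sc_eps _ _ _ _ B_cond). unfold left_strip. lra. Qed.

Lemma b_smooth : smooth_on 3 (left_strip eps d) (comp1 (normalized B)) /\
                 smooth_on 3 (left_strip eps d) (comp2 (normalized B)).
Proof.
  apply normalized_smooth.
  - apply left_strip_open.
  - exact left_strip_pos.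
  - apply Ck_plane_smooth_on. intros x y _. now apply B_C3.
  - apply Ck_plane_smooth_on. intros x y _. now apply B_C3.
Qed.

Lemma b_comp2_pos (x y : R) :
  left_strip eps d x y -> 0 < comp2 (normalized B) x y.
Proof. apply normalized_comp2_pos. exact left_strip_pos. Qed.

(** [comp1] of the field vanishes on the wall, so the mean value theorem from [0] to [x] bounds it
    by [x] times a bound of its derivative. *)
Lemma b_wall_bound (a T : R) : 0 < a < d / 2 ->
  exists M, forall x y, 0 <= x <= a -> Rabs (y - L / 2) <= T ->
    Rabs (comp1 (normalized B) x y) <= M * x.
Proof.
  intros Ha. destruct b_smooth as [Hb _].
  destruct (smooth_on_d_x 2 _ _ (left_strip_open eps d) Hb) as [Hs Hd].
  destruct (rectangle_bound (d_x (comp1 (normalized B))) 0 a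
              (L / 2 - T) (L / 2 + T)) as [M [_ HM]].
  { intros x y Hx _. apply (smooth_on_cont _ _ _ Hs), left_strip_range. lra. }
  exists M. intros x y Hx Hy.
  destruct (mvt_between (fun z => comp1 (normalized B) z y)
              (fun z => d_x (comp1 (normalized B)) z y) 0 x) as [c [Hc E]].
  - intros z Hz. apply Hd, left_strip_range.
    rewrite Rmin_left, Rmax_right in Hz; lra.
  - rewrite Rmin_left, Rmax_right in Hc by lra.
    assert (E0 : comp1 (normalized B) 0 y = 0).
    { unfold normalized, comp1 at 1. simpl.
      rewrite (proj1 (sc_Bx_walls _ _ _ _ B_cond y)). unfold Rdiv. ring. }
    rewrite E0, !Rminus_0_r in E. rewrite E, Rabs_mult, (Rabs_right x) by lra.
    apply Rmult_le_compat_r; [lra|]. apply HM; [lra|].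
    apply Rabs_le_between in Hy. lra.
Qed.

Lemma b_height_bound (a T : R) : 0 < a < d / 2 ->
  exists c, 0 < c /\ forall x y, 0 < x <= a -> Rabs (y - L / 2) <= T ->
    c <= comp2 (normalized B) x y.
Proof.
  intros Ha. destruct b_smooth as [_ Hb].
  destruct (rectangle_lower_bound (comp2 (normalized B)) 0 a
              (L / 2 - T) (L / 2 + T)) as [c [Hc H]].
  { intros x y Hx _.
    assert (Hs := left_strip_range x y ltac:(lra)).
    split; [now apply (smooth_on_cont _ _ _ Hb)|now apply b_comp2_pos]. }
  exists c. split; [exact Hc|]. intros x y Hx Hy. apply H; [lra|].
  apply Rabs_le_between in Hy. lra.
Qed.

Lemma b_comp1_low (x y : R) : 0 < x < d / 2 -> y < L / 2 ->
  0 < comp1 (normalized B) x y.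
Proof.
  intros Hx Hy. apply Rdiv_lt_0_compat.
  - apply (sc_Bx_in_low _ _ _ _ B_cond); lra.
  - apply enorm_pos, (left_strip_pos x y), left_strip_range. lra.
Qed.

Lemma b_comp1_up (x y : R) : 0 < x < d / 2 -> L / 2 < y ->
  comp1 (normalized B) x y < 0.
Proof.
  intros Hx Hy.
  assert (H1 : comp1 B x y < 0)
    by (apply (sc_Bx_in_up _ _ _ _ B_cond); lra).
  assert (H2 : 0 < / enorm (B x y)).
  { apply Rinv_0_lt_compat, enorm_pos, (left_strip_pos x y), left_strip_range.
    lra. }
  unfold normalized, comp1 at 1. simpl. unfold Rdiv. nra.
Qed.

(** The standing conditions prescribe the sign of [comp1 B] only above and below this height;
    continuity forces the value zero on it, and the positive second component normalizes to [1]. *)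
Lemma b_middle (x : R) : 0 < x < d / 2 -> normalized B x (L / 2) = (0, 1).
Proof.
  intros Hx.
  assert (E : comp1 B x (L / 2) = 0).
  { apply (sign_change_zero (fun y => comp1 B x y)).
    - apply continuity_2d_pt_section2. now apply B_C3.
    - intros y Hy. apply (sc_Bx_in_low _ _ _ _ B_cond); lra.
    - intros y Hy. apply (sc_Bx_in_up _ _ _ _ B_cond); lra. }
  assert (Hp := left_strip_pos x (L / 2) ltac:(apply left_strip_range; lra)).
  unfold normalized. rewrite E.
  assert (En : enorm (B x (L / 2)) = comp2 B x (L / 2)).
  { unfold enorm. fold (comp1 B x (L / 2)). fold (comp2 B x (L / 2)).
    rewrite E. replace (0 ^ 2 + comp2 B x (L / 2) ^ 2)
      with (Rsqr (comp2 B x (L / 2))) by (unfold Rsqr; ring).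
    apply sqrt_Rsqr. lra. }
  rewrite En. f_equal; field; lra.
Qed.

Variable Phi : R -> vec -> vec.
Hypothesis Phi_flow : is_flow B eps d L Phi.

(* [X x0 y] is the abscissa at height [y] of the trajectory from [(x0, L / 2)]. *)
Lemma flow_graph : exists X : R -> R -> R,
  (forall x, 0 < x < d / 2 -> X x (L / 2) = x) /\
  (forall x y, 0 < x < d / 2 -> is_derive (X x) y
     (comp1 (normalized B) (X x y) y / comp2 (normalized B) (X x y) y)) /\
  (forall x y, 0 < x < d / 2 -> 0 < X x y <= x) /\
  (forall x t, 0 < x < d / 2 ->
     fst (Phi t (x, L / 2)) = X x (snd (Phi t (x, L / 2)))) /\
  (forall x y, 0 < x < d / 2 -> exists t, snd (Phi t (x, L / 2)) = y).
Proof.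
  (* The range of [x] is a premise under the existential, with a dummy [tau] outside it, so that the
     axiom of choice applies over all of [R]. *)
  assert (Htau : forall x, exists tau : R -> R, 0 < x < d / 2 ->
    (forall z, snd (Phi (tau z) (x, L / 2)) = z) /\
    (forall t, tau (snd (Phi t (x, L / 2))) = t) /\
    (forall t, 0 < fst (Phi t (x, L / 2)) <= x) /\
    (forall z, is_derive (fun z => fst (Phi (tau z) (x, L / 2))) z
       (comp1 (normalized B) (fst (Phi (tau z) (x, L / 2))) z /
        comp2 (normalized B) (fst (Phi (tau z) (x, L / 2))) z))).
  { intros x. destruct (classic (0 < x < d / 2)) as [Hx|Hx];
      [|now exists (fun _ => 0)].
    assert (He := sc_eps _ _ _ _ B_cond).
    destruct (Phi_flow x ltac:(lra)) as [H0 Ht].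
    destruct (trajectory_graph (comp1 (normalized B)) (comp2 (normalized B))
      (d / 2) (L / 2) (fun t => fst (Phi t (x, L / 2)))
      (fun t => snd (Phi t (x, L / 2)))) as [tau [T1 [T2 [T3 T4]]]].
    - exact b_comp1_up.
    - exact b_comp1_low.
    - intros u v Hu. apply b_comp2_pos, left_strip_range. lra.
    - exact b_wall_bound.
    - exact b_height_bound.
    - intros t. apply Ht.
    - intros t. apply Ht.
    - rewrite H0. exact Hx.
    - now rewrite H0.
    - exists tau. intros _. rewrite H0 in T3. exact (conj T1 (conj T2 (conj T3 T4))). }
  destruct (ClassicalEpsilon.choice _ Htau) as [tau H]. clear Htau.
  exists (fun x y => fst (Phi (tau x y) (x, L / 2))).
  assert (H0 : forall x, 0 < x < d / 2 -> Phi 0 (x, L / 2) = (x, L / 2)).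
  { intros x Hx. assert (He := sc_eps _ _ _ _ B_cond).
    now destruct (Phi_flow x ltac:(lra)). }
  split; [|split; [|split; [|split]]].
  - intros x Hx. destruct (H x Hx) as [_ [T2 _]].
    specialize (T2 0). rewrite (H0 x Hx) in T2. simpl in T2.
    rewrite T2, (H0 x Hx). reflexivity.
  - intros x y Hx. apply (H x Hx).
  - intros x y Hx. apply (H x Hx).
  - intros x t Hx. destruct (H x Hx) as [_ [T2 _]]. now rewrite T2.
  - intros x y Hx. exists (tau x y). apply (H x Hx).
Qed.

End StandingConditions.

(** * Application of the abstract scalar flow to the normalized field on [D_region] *)

Lemma uncurry_fst_snd {T : Type} (w : R -> R -> T) (p : vec) :
  uncurry w p = w (fst p) (snd p).
Proof. now destruct p. Qed.

Theorem proposition1 (B : vfield) (eps d L : R)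
    (B_C3 : Ck_plane 3 (fun _ _ => True) (comp1 B) /\
            Ck_plane 3 (fun _ _ => True) (comp2 B))
    (B_cond : standing_conditions B eps d L)
    (Phi : R -> vec -> vec) (Phi_flow : is_flow B eps d L Phi)
    (alpha : R) (alpha_range : 0 < alpha < d / 2)
    (f : R -> R -> R) (f_C2 : Ck_plane 2 (D_region Phi d L alpha) f)
    (P Q : R -> R)
    (P_C2 : Ck_line 2 (fun x => 0 < x < alpha) P)
    (Q_C2 : Ck_line 2 (fun x => 0 < x < alpha) Q) :
  exists u : R -> R -> R,
    is_solution B L alpha (D_region Phi d L alpha) f P Q u /\
    (forall v : R -> R -> R,
       is_solution B L alpha (D_region Phi d L alpha) f P Q v ->
       forall x y, D_region Phi d L alpha x y -> v x y = u x y) /\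
    (forall x0 t, 0 < x0 < alpha ->
       uncurry u (F_map Phi L x0 t) =
         P x0
         + Q x0 * RInt (fun s => exp (- H_cal B Phi L x0 s)) 0 t
         + RInt (fun v => exp (- H_cal B Phi L x0 v) *
                          RInt (fun s => f_tilde f Phi L x0 s *
                                         exp (H_cal B Phi L x0 s)) 0 v) 0 t).
Proof.
  destruct (flow_graph B eps d L B_C3 B_cond Phi Phi_flow)
    as [X [X_start [X_ode [X_range [X_Phi X_onto]]]]].
  destruct (b_smooth B eps d L B_C3 B_cond) as [b1 b2].
  assert (b_pos := b_comp2_pos B eps d L B_cond).
  set (b := normalized B) in *.
  set (g := fun x y => comp1 b x y * / comp2 b x y).
  assert (Hg : smooth_on 3 (left_strip eps d) g).
  { apply smooth_on_mult; [exact b1|]. apply smooth_on_inv; [|exact b2].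
    intros x y Hxy. now apply Rgt_not_eq, b_pos. }
  destruct (smooth_on_d_x 2 _ _ (left_strip_open eps d) Hg) as [Hgx Hdg].
  assert (Hstrip := left_strip_range B eps d L B_cond).
  assert (HD : forall x y, D_region Phi d L alpha x y <-> X_region alpha X x y).
  { intros x y. unfold D_region, x_traj, y_traj, X_region. split.
    - intros [Hx [t [Ht Hxt]]]. rewrite X_Phi, Ht in Hxt by exact alpha_range.
      exact Hxt.
    - intros Hx. assert (R := X_range alpha y alpha_range).
      split; [lra|]. destruct (X_onto alpha y alpha_range) as [t Ht].
      exists t. split; [exact Ht|]. now rewrite X_Phi, Ht by exact alpha_range. }
  assert (HUs : forall x y, X_region alpha X x y -> left_strip eps d x y).
  { intros x y Hxy. apply Hstrip. unfold X_region in Hxy.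
    assert (R := X_range alpha y alpha_range). lra. }
  assert (g_der : forall x y, 0 < x < d / 2 ->
            is_derive (fun z => g z y) x (d_x g x y)).
  { intros x y Hx. apply Hdg, Hstrip. lra. }
  (* The case [x = 0] is covered because the wall is interior to [left_strip]. *)
  assert (gx_cont : forall x y, 0 <= x < d / 2 -> continuity_2d_pt (d_x g) x y).
  { intros x y Hx. apply (smooth_on_cont _ _ _ Hgx), Hstrip. lra. }
  assert (U_open : forall x y, X_region alpha X x y ->
            locally_2d (X_region alpha X) x y)
    by exact (X_region_open (d / 2) alpha g X alpha_range X_ode).
  assert (Ub1 := smooth_on_subset 3 _ _ _ HUs b1).
  assert (Ub2 := smooth_on_subset 3 _ _ _ HUs b2).
  assert (Ubp : forall x y, X_region alpha X x y -> 0 < comp2 b x y)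
    by (intros; apply b_pos, HUs; assumption).
  assert (Ug : smooth_on 2 (X_region alpha X) g).
  { apply smooth_on_subset with (1 := HUs). now apply smooth_on_pred. }
  assert (Ugx : smooth_on 2 (X_region alpha X) (d_x g))
    by exact (smooth_on_subset 2 _ _ _ HUs Hgx).
  assert (g_slope : forall x y, X_region alpha X x y ->
            g x y = comp1 b x y / comp2 b x y) by reflexivity.
  assert (Uf : smooth_on 2 (X_region alpha X) f).
  { apply Ck_plane_smooth_on. intros x y Hxy. now apply f_C2, HD. }
  (* The quotient in [X_ode] is [g] by conversion. Its body is then hidden, and [g_slope] keeps what
     the section requires. *)
  change (forall x y, 0 < x < d / 2 -> is_derive (X x) y (g (X x y) y)) in X_ode.
  clearbody g.
  set (u := solution alpha (L / 2) X b f P Q).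
  assert (start_region : forall x, 0 < x < alpha -> X_region alpha X x (L / 2)).
  { intros x Hx. unfold X_region. rewrite X_start; lra. }
  (* On the starting line the field is [(0, 1)], so the derivative along [b] is the derivative in
     [y]; this identifies the two forms of the second initial condition. *)
  assert (Hmid : forall w x, 0 < x < alpha ->
    along_b b w x (L / 2) = d_y w x (L / 2) /\
    dot (grad w x (L / 2)) (b x (L / 2)) = d_y w x (L / 2)).
  { intros w x Hx.
    assert (Eb : b x (L / 2) = (0, 1))
      by (apply (b_middle B eps d L B_C3 B_cond); lra).
    unfold along_b, comp1, comp2, dot, grad. rewrite Eb. simpl. split; ring. }
  assert (u_smooth : smooth_on 2 (X_region alpha X) u).
  { apply (solution_smooth (d / 2) alpha (L / 2) g (d_x g) X); assumption. }
  exists u. split; [|split].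
  - split; [|split; [|split]].
    + intros x y Hxy. apply (smooth_on_Ck_plane 2 _ _ U_open u_smooth).
      now apply HD.
    + intros x y Hxy. apply HD in Hxy.
      now apply (solution_equation (d / 2) alpha (L / 2) g (d_x g) X).
    + intros x Hx. now apply (solution_start (d / 2) alpha (L / 2) g (d_x g) X).
    + intros x Hx. destruct (Hmid u x Hx) as [E1 E2]. split; [exact E2|].
      rewrite <- E1.
      transitivity (flux alpha (L / 2) X b f Q x (L / 2)).
      * apply (along_b_solution (d / 2) alpha (L / 2) g (d_x g) X);
          try assumption. now apply start_region.
      * now apply (flux_start (d / 2) alpha (L / 2) g (d_x g) X).
  - intros v [Hv1 [Hv2 [Hv3 Hv4]]] x y Hxy. apply HD in Hxy.
    apply (solution_unique (d / 2) alpha (L / 2) g (d_x g) X); try assumption.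
    + apply Ck_plane_smooth_on. intros r s Hrs. now apply Hv1, HD.
    + intros r s Hrs. now apply Hv2, HD.
    + intros r Hr. rewrite (proj1 (Hmid v r Hr)). now apply Hv4.
  - intros x t Hx. unfold F_map. rewrite uncurry_fst_snd.
    assert (He := sc_eps _ _ _ _ B_cond).
    destruct (Phi_flow x ltac:(lra)) as [H0 Ht].
    set (H := fun s =>
      RInt (fun t => divergence b (fst (Phi t (x, L / 2))) (snd (Phi t (x, L / 2))))
        0 s).
    (* The trace of the Jacobian is the divergence by unfolding. *)
    assert (EH : forall s, H_cal B Phi L x s = H s).
    { intros s. apply RInt_ext. intros r _. unfold H_tilde.
      now rewrite uncurry_fst_snd. }
    rewrite (RInt_ext (fun s => exp (- H_cal B Phi L x s)) (fun s => exp (- H s)))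
      by (intros s _; now rewrite EH).
    rewrite (RInt_ext (fun v => exp (- H_cal B Phi L x v) *
      RInt (fun s => f_tilde f Phi L x s * exp (H_cal B Phi L x s)) 0 v) (fun v => exp (- H v) * RInt (fun s =>
      - f (fst (Phi s (x, L / 2))) (snd (Phi s (x, L / 2))) * exp (H s)) 0 v) 0 t).
    + apply (solution_formula (d / 2) alpha (L / 2) g (d_x g) X) with
        (xx := fun t => fst (Phi t (x, L / 2)))
        (yy := fun t => snd (Phi t (x, L / 2))); try assumption.
      * now rewrite H0.
      * intros s. apply X_Phi. lra.
      * intros s. apply Ht.
    + intros s _. rewrite EH. apply (Rmult_eq_compat_l (exp (- H s))).
      apply RInt_ext. intros r _.
      rewrite EH. unfold f_tilde. now rewrite uncurry_fst_snd.
Qed.
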